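(* Suppose that for every $f\in L^\infty(0,\infty;H)$ the nudging filter $$\begin{aligned}\tfrac{dv}{dt}+\nu Av+B(v,v)&=f-\mu P_Nv+\mu P_Nu,\quad v(0)=v_0,\\ \tfrac{du}{dt}+\nu Au+B(u,u)&=f,\quad u(0)=u_0,\end{aligned}$$ has the synchronization property, i.e. there exist an increasing function $\mu_*:(0,\infty)\to(0,\infty)$, independent of $f$, and $N_*>0$ depending continuously on $\sup_t|f(t)|$ and $\nu$, such that $|v(t)-u(t)|\to0$ as $t\to\infty$ for every $N\ge N_*$, every $\mu\in[\mu_*(N_* ),\mu_*(N)]$ and all $u_0,v_0\in V$. Then the 2D Navier–Stokes equations have the finite determining modes property: for all $f_1,f_2\in L^\infty(0,\infty;H)$ there exists $N>0$ such that for all $u_0^1,u_0^2\in V$, the global strong solutions $u_j$ of $\frac{du_j}{dt}+\nu Au_j+B(u_j,u_j)=f_j$, $u_j(0)=u_0^j$, satisfy: if $|P_Nu_1(t)-P_Nu_2(t)|\to0$ and $|f_1(t)-f_2(t)|\to0$ as $t\to\infty$, then $|u_1(t)-u_2(t)|\to0$ as $t\to\infty$.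
   Context: Let $\Omega=[0,2\pi]^2$ with periodic boundary conditions. $H$ is the space of $2\pi$-periodic, divergence-free, mean-free vector fields in $L^2(\Omega)^2$, with inner product $(u,v)=\int_\Omega u\cdot v\,dx$ and norm $|u|=(u,u)^{1/2}$; $V$ is the subspace of $H$ consisting of fields in $H^1$, with norm $\|u\|=|\nabla u|$. $\mathbb P$ is the Leray projection, $A=-\mathbb P\Delta$ is the Stokes operator with domain $D(A)$, and $B(u,v)=\mathbb P((u\cdot\nabla)v)$. For real $N>0$, $P_N$ is the orthogonal projection onto the Fourier modes with wavenumbers $k\in\mathbb Z^2\setminus\{0\}$, $|k|\le N$. $\nu>0$ is the viscosity, $\mu>0$ the nudging parameter. Global strong solution: $C([0,T];V)\cap L^2(0,T;D(A))$ for every $T>0$; both systems above are globally well-posed in this sense. *)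

(* Defs.v *)
From HB Require Import structures.
From mathcomp Require Import all_boot all_order all_algebra.
From mathcomp Require Import all_classical all_reals all_analysis.
From mathcomp Require Import measurable_realfun.
Import Order.TTheory GRing.Theory Num.Theory.
Import numFieldNormedType.Exports.

Set Implicit Arguments.
Unset Strict Implicit.
Unset Printing Implicit Defensive.

Local Open Scope classical_set_scope.
Local Open Scope ring_scope.

Section NSE.
Variable R : realType.

Definition cpx := (R * R)%type.
Definition cadd (a b : cpx) : cpx := (a.1 + b.1, a.2 + b.2).
Definition cscale (r : R) (a : cpx) : cpx := (r * a.1, r * a.2).
Definition cmul (a b : cpx) : cpx := (a.1 * b.1 - a.2 * b.2, a.1 * b.2 + a.2 * b.1).
Definition cconj (a : cpx) : cpx := (a.1, - a.2).
Definition cmulI (a : cpx) : cpx := (- a.2, a.1).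
Definition cnorm2 (a : cpx) : R := a.1 ^+ 2 + a.2 ^+ 2.
Definition c0 : cpx := (0, 0).

Definition idx := (int * int)%type.
Definition k0 : idx := (0%Z, 0%Z).
Definition kneg (k : idx) : idx := ((- k.1)%R, (- k.2)%R).
Definition ksub (k p : idx) : idx := ((k.1 - p.1)%R, (k.2 - p.2)%R).
Definition kx (k : idx) : R := k.1%:~R.
Definition ky (k : idx) : R := k.2%:~R.
Definition ksq (k : idx) : R := kx k ^+ 2 + ky k ^+ 2.

(** A Fourier coefficient of a planar vector field: two complex components. *)
Definition vec := (cpx * cpx)%type.
Definition vec0 : vec := (c0, c0).
Definition vadd (w z : vec) : vec := (cadd w.1 z.1, cadd w.2 z.2).
Definition vscale (r : R) (w : vec) : vec := (cscale r w.1, cscale r w.2).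
Definition vsub (w z : vec) : vec := vadd w (vscale (-1) z).
Definition vconj (w : vec) : vec := (cconj w.1, cconj w.2).
Definition vmulI (w : vec) : vec := (cmulI w.1, cmulI w.2).
Definition cvmul (a : cpx) (w : vec) : vec := (cmul a w.1, cmul a w.2).
Definition vnorm2 (w : vec) : R := cnorm2 w.1 + cnorm2 w.2.
Definition kdot (k : idx) (w : vec) : cpx := cadd (cscale (kx k) w.1) (cscale (ky k) w.2).
Definition leray (k : idx) (w : vec) : vec :=
  vsub w (cscale (kx k / ksq k) (kdot k w), cscale (ky k / ksq k) (kdot k w)).
Definition coord (w : vec) (i : 'I_4) : R :=
  match val i with 0%N => w.1.1 | 1%N => w.1.2 | 2%N => w.2.1 | _ => w.2.2 end.

(** Vector fields on the torus [0,2pi]^2, given by their Fourier coefficients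
    u(x) = sum_k u k e^{i k.x}. *)
Definition field := idx -> vec.
Definition fadd (u v : field) : field := fun k => vadd (u k) (v k).
Definition fsub (u v : field) : field := fun k => vsub (u k) (v k).
Definition fscale (r : R) (u : field) : field := fun k => vscale r (u k).

Definition sumZ2 (g : idx -> R) : \bar R := (\esum_(k in [set: idx]) (g k)%:E)%E.

(* membership in H: real-valued (Hermitian symmetry), mean-free,
   divergence-free, square integrable *)
Definition inH (u : field) : Prop :=
  [/\ u k0 = vec0,
      forall k, u (kneg k) = vconj (u k),
      forall k, kdot k (u k) = c0 &
      (sumZ2 (fun k => vnorm2 (u k)) < +oo)%E].

Definition inV (u : field) : Prop :=
  inH u /\ (sumZ2 (fun k => (ksq k * vnorm2 (u k))%R) < +oo)%E.

(* |u| = (int_Omega |u|^2)^{1/2} = (4 pi^2 sum_k |u_k|^2)^{1/2}  (Parseval) *)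
Definition normH (u : field) : R :=
  Num.sqrt (4 * pi ^+ 2 * fine (sumZ2 (fun k => vnorm2 (u k)))).
(* ||u|| = |grad u| *)
Definition normV (u : field) : R :=
  Num.sqrt (4 * pi ^+ 2 * fine (sumZ2 (fun k => ksq k * vnorm2 (u k)))).
(* |A u|^2 as an extended real (+oo when u is not in D(A)) *)
Definition normA2 (u : field) : \bar R :=
  ((4 * pi ^+ 2)%:E * sumZ2 (fun k => (ksq k ^+ 2 * vnorm2 (u k))%R))%E.

Definition stokesA (u : field) : field := fun k => vscale (ksq k) (u k).

Definition PN (N : R) (u : field) : field :=
  fun k => if ksq k <= N ^+ 2 then u k else vec0.

(* B(u,v) = P((u.grad) v): its k-th coefficient is
   P_k ( i sum_{p+q=k} (u_p . q) v_q ); the (absolutely convergent, for the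
   fields considered) series is taken as the limit of the partial sums over
   the squares max(|p1|,|p2|) <= n. *)
Definition conv_part (u v : field) (k : idx) (n : nat) : vec :=
  \big[vadd/vec0]_(i < (2 * n).+1) \big[vadd/vec0]_(j < (2 * n).+1)
     (let p : idx := ((i%:Z - n%:Z)%R, (j%:Z - n%:Z)%R) in
      let q := ksub k p in cvmul (kdot q (u p)) (v q)).

Definition seqlim (s : nat -> R) : R := lim (s @ \oo).

Definition vlim (s : nat -> vec) : vec :=
  ((seqlim (fun n => (s n).1.1), seqlim (fun n => (s n).1.2)),
   (seqlim (fun n => (s n).2.1), seqlim (fun n => (s n).2.2))).

Definition bilB (u v : field) : field := fun k =>
  if k == k0 then vec0 else leray k (vmulI (vlim (conv_part u v k))).

(** u is a global strong solution on [0,oo) of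
      du/dt + nu A u + B(u,u) = g(t),
    i.e. u in C([0,T];V) /\ L^2(0,T;D(A)) for every T > 0 and the equation
    holds in integrated form (each Fourier coordinate of u is the integral
    of the corresponding coordinate of the right-hand side). *)
Definition strong_sol (nu : R) (g : R -> field) (u : R -> field) : Prop :=
  [/\ (forall t, 0 <= t -> inV (u t)),
      (forall t, 0 <= t -> forall e, 0 < e -> exists2 d, 0 < d &
          forall s, 0 <= s -> `|s - t| < d -> normV (fsub (u s) (u t)) < e),
      (forall T : R, 0 < T ->
          measurable_fun `[0, T] (fun t => normA2 (u t)) /\
          (\int[lebesgue_measure]_(t in `[0%R, T]) normA2 (u t) < +oo)%E) &
      (forall (k : idx) (i : 'I_4) (t : R), 0 <= t ->
          let F := fun s : R => coord
              (vsub (g s k) (vadd (vscale nu (stokesA (u s) k)) (bilB (u s) (u s) k))) i in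
          lebesgue_measure.-integrable `[0, t] (fun s => (F s)%:E) /\
          coord (u t k) i = coord (u 0 k) i +
             fine (\int[lebesgue_measure]_(s in `[0%R, t]) (F s)%:E)%E)].

(** f in L^infty(0,oo;H) (represented by an everywhere bounded,
    measurable representative). *)
Definition Linf_H (f : R -> field) : Prop :=
  [/\ (forall t, 0 <= t -> inH (f t)),
      (forall (k : idx) (i : 'I_4), measurable_fun `[(0 : R), +oo[ (fun t : R => coord (f t k) i)) &
      exists M, forall t, 0 <= t -> normH (f t) <= M].

Definition supnorm (f : R -> field) : R :=
  sup [set x | exists2 t, 0 <= t & x = normH (f t)].

Definition tends0 (h : R -> R) : Prop := h t @[t --> +oo] --> 0.

Definition nudge (f : R -> field) (mu N : R) (u v : R -> field) : R -> field :=
  fun t => fadd (f t) (fsub (fscale mu (PN N (u t))) (fscale mu (PN N (v t)))).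

Definition synchronization (nu : R) : Prop :=
  exists (mustar : R -> R) (Nstar : R -> R),
    (forall x, 0 < x -> 0 < mustar x) /\
    (forall x y, 0 < x -> x < y -> mustar x < mustar y) /\
    (forall x, 0 <= x -> 0 < Nstar x) /\
    {within `[0, +oo[, continuous Nstar} /\
    forall f, Linf_H f ->
      let Ns := Nstar (supnorm f) in
      forall N mu, Ns <= N -> mustar Ns <= mu <= mustar N ->
      forall u v : R -> field,
        strong_sol nu f u ->
        strong_sol nu (nudge f mu N u v) v ->
        tends0 (fun t => normH (fsub (v t) (u t))).

Definition finite_determining_modes (nu : R) : Prop :=
  forall f1 f2, Linf_H f1 -> Linf_H f2 ->
    exists2 N, 0 < N &
      forall u1 u2 : R -> field,
        strong_sol nu f1 u1 -> strong_sol nu f2 u2 ->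
        tends0 (fun t => normH (fsub (PN N (u1 t)) (PN N (u2 t)))) ->
        tends0 (fun t => normH (fsub (f1 t) (f2 t))) ->
        tends0 (fun t => normH (fsub (u1 t) (u2 t))).

End NSE.

(* Main.v *)
Require Import Defs.
From mathcomp Require Import all_boot all_order all_algebra.
From mathcomp Require Import all_classical all_reals all_analysis.
From mathcomp Require Import measurable_realfun.
From mathcomp Require Import ring lra zify.
Import Order.TTheory GRing.Theory Num.Theory.
Import numFieldNormedType.Exports.
Set Implicit Arguments.
Unset Strict Implicit.
Unset Printing Implicit Defensive.
Local Open Scope ring_scope.

(** The determining modes property is proved by the energy method of Foias and
    Prodi.  Let w = u1 - u2, y = |w|^2 and z = |u2|^2 (up to the factor 4 pi^2).
    - On Fourier coefficients the trilinear form satisfies, for every M >= 1,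
      |(B(w,u2),w)| <= 10 (M |w|^2 + ||w||^2 / M) ||u2||, a form of
      Ladyzhenskaya's inequality, while (B(u1,w),w) = 0.
    - With M proportional to ||u2|| and ||w||^2 >= N^2 (|w|^2 - |P_N w|^2), this
      gives y' <= - (nu N^2 - 2 nu - 500 ||u2||^2 / nu) y + o(1), and the energy
      inequality for u2 is z' <= - nu ||u2||^2 + F^2 / nu with F = sup |f2|.
    - Hence, for D = 500 / nu^2 and N^2 = 3 + 500 F^2 / nu^4, the bounded factor
      exp(D z) absorbs the term in ||u2||^2: Y = y exp(D z) satisfies
      Y' <= - nu Y + o(1), so that Y, and therefore y, tends to 0.
    Only right upper Dini derivatives of y and z are used.  By continuity in V
    they come from
    |w_k(s)|^2 - |w_k(t)|^2 = (w_k(s) + w_k(t)) . (w_k(s) - w_k(t)),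
    where w_k(s) - w_k(t) is the integral of the equation over ]t, s]. *)

(** * Finite sums over the lattice *)

(** The order of quantifiers shapes the argument: N is fixed from the forces before the initial data
    are known. No bound on ||u2|| at single times is derived; the energy inequality controls only
    its time average. The weight exp(D z) turns this averaged control into a differential inequality
    that holds at every time, and u2(0) enters only through the bound on z, which multiplies the
    o(1) term and leaves N untouched.

    The second obstacle is regularity. The equation is given mode by mode and integrated in time,
    with forces that are only measurable, so |w|^2 is not known to be differentiable. Every estimate
    is therefore made on a finite box of modes with constants independent of the box. At a fixed
    base time t the box is enlarged until (B(u1,w),w) and the tail of ||w||^2 are negligible, and
    continuity in V carries the estimate to a short interval [t, s] whose length does not depend on
    the box. *)

Section FiniteSums.
Context {R : realType}.

Lemma ler_of_sqr (x y : R) : 0 <= y -> x ^+ 2 <= y ^+ 2 -> x <= y.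
Proof.
move=> y0 h; have [x0|x0] := leP 0 x; last exact: le_trans (ltW x0) y0.
by rewrite -(@ler_pXn2r _ 2%N) // nnegrE.
Qed.

(** Summing (x a_i - y b_i)^2 >= 0 gives [key] for all x and y, and x = B, y = A is the optimal
    choice when A B > 0. Arbitrary upper bounds A and B are allowed because later they are norms of
    whole fields, while the sums are finite. *)
Lemma sum_CauchySchwarz (I : Type) (s : seq I) (a b : I -> R) (A B : R) :
  0 <= A -> 0 <= B ->
  \sum_(i <- s) a i ^+ 2 <= A ^+ 2 -> \sum_(i <- s) b i ^+ 2 <= B ^+ 2 ->
  \sum_(i <- s) a i * b i <= A * B.
Proof.
move=> A0 B0 hA hB.
have key (x y : R) : 2 * x * y * (\sum_(i <- s) a i * b i) <=
    x ^+ 2 * A ^+ 2 + y ^+ 2 * B ^+ 2.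
  apply: (@le_trans _ _ (x ^+ 2 * \sum_(i <- s) a i ^+ 2 +
                         y ^+ 2 * \sum_(i <- s) b i ^+ 2)).
    rewrite !mulr_sumr -big_split /=; apply: ler_sum => i _.
    have := sqr_ge0 (x * a i - y * b i); lra.
  by apply: lerD; apply: ler_wpM2l => //; exact: sqr_ge0.
set S := \sum_(i <- s) a i * b i.
have {}key (x y : R) : 2 * x * y * S <= x ^+ 2 * A ^+ 2 + y ^+ 2 * B ^+ 2.
  exact: key.
have [AB0|AB0] := eqVneq (A * B) 0.
  rewrite AB0 leNgt; apply/negP => S0.
  move/eqP: AB0; rewrite mulf_eq0 => /orP[/eqP A00|/eqP B00].
    (* With A = 0 the factor x is free on the right-hand side; this value makes the left-hand side 2
       (B^2 + 1), which exceeds B^2. *)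
    have := key ((B ^+ 2 + 1) / S) 1; rewrite A00.
    have -> : 2 * ((B ^+ 2 + 1) / S) * 1 * S = 2 * (B ^+ 2 + 1).
      by field; rewrite gt_eqF.
    have := sqr_ge0 B; lra.
  have := key 1 ((A ^+ 2 + 1) / S); rewrite B00.
  have -> : 2 * 1 * ((A ^+ 2 + 1) / S) * S = 2 * (A ^+ 2 + 1).
    by field; rewrite gt_eqF.
  have := sqr_ge0 A; lra.
have AB1 : 0 < A * B by rewrite lt0r AB0 mulr_ge0.
have := key B A.
have -> : 2 * B * A * S = 2 * (A * B) * S by ring.
have -> : B ^+ 2 * A ^+ 2 + A ^+ 2 * B ^+ 2 = 2 * (A * B) * (A * B) by ring.
by rewrite ler_pM2l // mulr_gt0.
Qed.

Lemma ler_sum_seq_sub (I : eqType) (s t : seq I) (g : I -> R) :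
  uniq s -> {subset s <= t} -> (forall i, 0 <= g i) ->
  \sum_(i <- s) g i <= \sum_(i <- t) g i.
Proof.
elim: s t => [|x s IH] t; first by move=> *; rewrite big_nil sumr_ge0.
rewrite cons_uniq => /andP[xs us] st g0.
have xt : x \in t by apply: st; rewrite mem_head.
rewrite big_cons (perm_big _ (perm_to_rem xt)) big_cons lerD2l.
apply: IH => // y ys.
have yt : y \in t by apply: st; rewrite in_cons ys orbT.
move: yt; rewrite (perm_mem (perm_to_rem xt)) in_cons => /orP[/eqP yx|//].
by rewrite yx in ys; rewrite ys in xs.
Qed.

End FiniteSums.

(** * Square boxes of Z^2 and the square summability of (M^2 + |p|^2)^-1 *)

Section Boxes.
Context {R : realType}.

Definition segz (n : nat) : seq int := [seq i%:Z - n%:Z | i <- iota 0 (2 * n).+1].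
Definition bx (n : nat) : seq idx := [seq (i, j) | i <- segz n, j <- segz n].

Arguments segz : simpl never.
Arguments bx : simpl never.

Lemma mem_segz n (z : int) : (z \in segz n) = (`|z| <= n)%N.
Proof.
apply/mapP/idP => [[i]|h].
  rewrite mem_iota; lia.
exists (`|(z + n%:Z)%R|)%N; last lia.
rewrite mem_iota; lia.
Qed.

Lemma segz_uniq n : uniq (segz n).
Proof. rewrite map_inj_uniq ?iota_uniq // => i j; lia. Qed.

Lemma mem_bx n (k : idx) : (k \in bx n) = (`|k.1| <= n)%N && (`|k.2| <= n)%N.
Proof.
case: k => a b; rewrite -!mem_segz; apply/allpairsP/andP => /=.
  by case=> -[i j] /= [ii jj [-> ->]].
by case=> ha hb; exists (a, b).
Qed.

Lemma bx_uniq n : uniq (bx n).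
Proof. by apply: allpairs_uniq; rewrite ?segz_uniq // => -[a b] [c d] _ _. Qed.

Lemma bx_sub m n : (m <= n)%N -> {subset bx m <= bx n}.
Proof. move=> mn k; rewrite !mem_bx; lia. Qed.

Lemma seq_sub_bx (s : seq idx) : exists n, {subset s <= bx n}.
Proof.
elim: s => [|k s [n IH]]; first by exists 0%N.
exists (n + `|k.1| + `|k.2|)%N => p; rewrite in_cons => /orP[/eqP ->|/IH].
  rewrite mem_bx; lia.
by apply: bx_sub; lia.
Qed.

Lemma sum_bx (V : nmodType) n (g : idx -> V) : \sum_(k <- bx n) g k =
  \sum_(i < (2 * n).+1) \sum_(j < (2 * n).+1) g (i%:Z - n%:Z, j%:Z - n%:Z).
Proof.
rewrite /bx big_allpairs /segz big_map.
rewrite -[iota 0 _]/(index_iota 0 (2 * n).+1) big_mkord.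
by apply: eq_bigr => i _; rewrite big_map big_mkord.
Qed.

Lemma perm_bxN n : perm_eq [seq - k | k <- bx n] (bx n).
Proof.
apply: uniq_perm; rewrite ?bx_uniq //.
  by rewrite map_inj_uniq ?bx_uniq //; exact: oppr_inj.
move=> k; rewrite -[k in LHS]opprK mem_map; last exact: oppr_inj.
by rewrite !mem_bx -[(- k).1]/(- k.1) -[(- k).2]/(- k.2) !abszN.
Qed.

(** Since (M + j - 1) (M + j) <= 2 (M^2 + j^2), the term of index j >= 1 is at most 2 (1 / (M + j -
    1) - 1 / (M + j)), which telescopes to 2 / M. The two half-lines and the term j = 0, at most 1 /
    M, add up to 5 / M. *)
Lemma sum_inv_quad_segz (M : R) n : 1 <= M ->
  \sum_(j <- segz n) (M ^+ 2 + j%:~R ^+ 2)^-1 <= 5 / M.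
Proof.
move=> M1; have M0 : 0 < M by lra.
pose P (m : nat) := \sum_(0 <= j < m) (M ^+ 2 + (j.+1)%:R ^+ 2)^-1.
have hP m : P m <= 2 * (M^-1 - (M + m%:R)^-1).
  elim: m => [|m IH]; first by rewrite /P big_nil addr0 subrr mulr0.
  rewrite /P big_nat_recr //= -/(P m); apply: le_trans (lerD IH (lexx _)) _.
  set x : R := m%:R; have x0 : 0 <= x by rewrite /x ler0n.
  rewrite -[m.+1%:R]natr1 -/x -subr_ge0.
  have d1 : 0 < M + x by lra.
  have d2 : 0 < M + (x + 1) by lra.
  have d3 : 0 < M ^+ 2 + (x + 1) ^+ 2 by nra.
  have -> : 2 * (M^-1 - (M + (x + 1))^-1) -
      (2 * (M^-1 - (M + x)^-1) + (M ^+ 2 + (x + 1) ^+ 2)^-1) =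
      (2 * (M ^+ 2 + (x + 1) ^+ 2) - (M + x) * (M + (x + 1))) /
      ((M + x) * (M + (x + 1)) * (M ^+ 2 + (x + 1) ^+ 2)).
    by field; rewrite !gt_eqF.
  apply: divr_ge0; last by rewrite !mulr_ge0 // ltW.
  have := sqr_ge0 (M - (x + 1)); nra.
have hs : \sum_(j <- segz n) (M ^+ 2 + j%:~R ^+ 2)^-1 <=
    M ^- 2 + (P n + P n).
  apply: (@le_trans _ _ (\sum_(j <- 0%Z :: ([seq i.+1%:Z | i <- iota 0 n] ++
       [seq - i.+1%:Z | i <- iota 0 n])) (M ^+ 2 + j%:~R ^+ 2)^-1)).
    apply: ler_sum_seq_sub; first exact: segz_uniq.
      move=> z; rewrite mem_segz in_cons mem_cat => hz.
      have [->//|z0] := eqVneq z 0%Z; apply/orP; right.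
      have [zp|zn] := leP 0 z.
        apply/orP; left; apply/mapP; exists (`|z|.-1)%N; last lia.
        rewrite mem_iota; lia.
      apply/orP; right; apply/mapP; exists (`|z|.-1)%N; last lia.
      rewrite mem_iota; lia.
    by move=> z; rewrite invr_ge0 addr_ge0 // sqr_ge0.
  rewrite big_cons big_cat !big_map /= expr0n addr0 /P /index_iota subn0.
  rewrite lerD2l; apply: lerD; apply: ler_sum => i _ //.
  by rewrite mulrNz sqrrN.
apply: le_trans hs _.
have Pn : P n <= 2 * M^-1.
  apply: le_trans (hP n) _; rewrite ler_pM2l // lerBlDr lerDl invr_ge0.
  have : 0 <= n%:R :> R by rewrite ler0n.
  lra.
have : M ^- 2 <= M^-1.
  by rewrite -exprVn expr2 ler_piMl ?invr_ge0 ?(ltW M0) // invf_le1.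
lra.
Qed.

Lemma ksq_ge0 (k : idx) : 0 <= ksq R k.
Proof. by rewrite addr_ge0 // sqr_ge0. Qed.

(** From (M^2 + a + b)^2 >= (M^2 + a) (M^2 + b) the sum over a box is bounded by a product of two
    one-dimensional sums. *)
Lemma sum_inv_quad2 (M : R) (s : seq idx) : 1 <= M -> uniq s ->
  \sum_(p <- s) ((M ^+ 2 + ksq R p)^-1) ^+ 2 <= (5 / M) ^+ 2.
Proof.
move=> M1 us; have [n sn] := seq_sub_bx s.
apply: le_trans (ler_sum_seq_sub us sn _) _; first by move=> p; exact: sqr_ge0.
apply: (@le_trans _ _ (\sum_(p <- bx n)
    (M ^+ 2 + kx R p ^+ 2)^-1 * (M ^+ 2 + ky R p ^+ 2)^-1)).
  apply: ler_sum => p _; have := sqr_ge0 (kx R p); have := sqr_ge0 (ky R p).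
  have : 1 <= M ^+ 2 by nra.
  rewrite /ksq; set a := kx R p ^+ 2; set b := ky R p ^+ 2; set m := M ^+ 2.
  move=> m1 b0 a0; rewrite exprVn -invfM lef_pV2 ?posrE; [nra|nra|nra].
rewrite /bx big_allpairs /= /kx /ky /=.
under eq_bigr do rewrite -mulr_sumr.
rewrite -mulr_suml expr2.
have g0 : 0 <= \sum_(i <- segz n) (M ^+ 2 + i%:~R ^+ 2)^-1 :> R.
  by apply: sumr_ge0 => i _; rewrite invr_ge0 addr_ge0 // sqr_ge0.
by apply: ler_pM => //; exact: sum_inv_quad_segz.
Qed.

End Boxes.

(** * Convolution sums over the lattice *)

Section Trilinear.
Context {R : realType}.
Implicit Types a b c : idx -> R.

(** The bound on b is required on all duplicate-free lists because p -> k - p moves the list s to an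
    arbitrary place of the lattice. *)
Lemma sum_conv_le b c (k : idx) (s : seq idx) (B C : R) :
  0 <= B -> 0 <= C -> uniq s ->
  (forall t : seq idx, uniq t -> \sum_(q <- t) b q ^+ 2 <= B ^+ 2) ->
  (\sum_(p <- s) c p ^+ 2 <= C ^+ 2) ->
  \sum_(p <- s) c p * b (k - p) <= C * B.
Proof.
move=> B0 C0 us hB hC; apply: sum_CauchySchwarz => //.
have := hB [seq k - p | p <- s]; rewrite big_map; apply.
by rewrite map_inj_uniq // => x y /addrI /oppr_inj.
Qed.

Lemma sum_conv_shift_le b c (p : idx) (s : seq idx) (B C : R) :
  0 <= B -> 0 <= C -> uniq s ->
  (forall t : seq idx, uniq t -> \sum_(q <- t) b q ^+ 2 <= B ^+ 2) ->
  (\sum_(p <- s) c p ^+ 2 <= C ^+ 2) ->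
  \sum_(k <- s) c k * b (k - p) <= C * B.
Proof.
move=> B0 C0 us hB hC; apply: sum_CauchySchwarz => //.
have := hB [seq k - p | k <- s]; rewrite big_map; apply.
by rewrite map_inj_uniq // => x y /addIr.
Qed.

(* On |p| <= |k| write a_p c_k <= (a_p / om_p) (om_k c_k) with
   om_p^2 = M^2 + |p|^2; then om_p^-2 is square summable over Z^2 with norm
   at most 5 / M, and Cauchy-Schwarz in k applies for each fixed p. *)
Lemma trilinear_le (M : R) a b c (K P : seq idx) (A B C : R) :
  1 <= M -> 0 <= A -> 0 <= B -> 0 <= C -> uniq K -> uniq P ->
  (forall k, 0 <= a k) -> (forall k, 0 <= b k) -> (forall k, 0 <= c k) ->
  \sum_(p <- P) (M ^+ 2 + ksq R p) * a p ^+ 2 <= A ^+ 2 ->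
  (forall t : seq idx, uniq t -> \sum_(q <- t) b q ^+ 2 <= B ^+ 2) ->
  \sum_(k <- K) (M ^+ 2 + ksq R k) * c k ^+ 2 <= C ^+ 2 ->
  \sum_(k <- K) \sum_(p <- P) a p * c k * b (k - p) <= 10 / M * (A * C * B).
Proof.
move=> M1 A0 B0 C0 uK uP a0 b0 c0 hA hB hC.
have M0 : 0 < M by lra.
pose om2 p : R := M ^+ 2 + ksq R p.
pose om p : R := Num.sqrt (om2 p).
have om2_gt0 p : 0 < om2 p.
  by rewrite /om2; have := ksq_ge0 (R := R) p; nra.
have om_gt0 p : 0 < om p by rewrite sqrtr_gt0.
have omE p : om p ^+ 2 = om2 p by rewrite sqr_sqrtr // ltW.
have sqE (T : seq idx) (y : idx -> R) :
    \sum_(k <- T) (om k * y k) ^+ 2 = \sum_(k <- T) om2 k * y k ^+ 2.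
  by apply: eq_bigr => k _; rewrite exprMn omE.
have half (x : idx -> R) (S : seq idx) (X : R) : 0 <= X -> uniq S ->
    \sum_(p <- S) om2 p * x p ^+ 2 <= X ^+ 2 ->
    \sum_(p <- S) x p / om p <= X * (5 / M).
  move=> X0 uS hX.
  have -> : \sum_(i <- S) x i / om i = \sum_(i <- S) (om i * x i) * (om2 i)^-1.
    by apply: eq_bigr => i _; rewrite -omE; field; rewrite gt_eqF.
  apply: sum_CauchySchwarz; rewrite ?sqE //; first by rewrite divr_ge0 // ltW.
  exact: sum_inv_quad2.
have h1 : \sum_(p <- P) a p / om p * (\sum_(k <- K) om k * c k * b (k - p)) <=
    5 / M * (A * C * B).
  apply: (@le_trans _ _ (\sum_(p <- P) a p / om p * (C * B))).
    apply: ler_sum => p _; apply: ler_wpM2l; first by rewrite divr_ge0 // ltW.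
    by apply: sum_conv_shift_le => //; rewrite sqE.
  rewrite -mulr_suml.
  have -> : 5 / M * (A * C * B) = A * (5 / M) * (C * B) by ring.
  by apply: ler_wpM2r; [exact: mulr_ge0 | exact: half].
have h2 : \sum_(k <- K) c k / om k * (\sum_(p <- P) om p * a p * b (k - p)) <=
    5 / M * (C * A * B).
  apply: (@le_trans _ _ (\sum_(k <- K) c k / om k * (A * B))).
    apply: ler_sum => k _; apply: ler_wpM2l; first by rewrite divr_ge0 // ltW.
    by apply: sum_conv_le => //; rewrite sqE.
  rewrite -mulr_suml.
  have -> : 5 / M * (C * A * B) = C * (5 / M) * (A * B) by ring.
  by apply: ler_wpM2r; [exact: mulr_ge0 | exact: half].
have -> : 10 / M * (A * C * B) =
    5 / M * (A * C * B) + 5 / M * (C * A * B) by field; rewrite gt_eqF.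
apply: le_trans (lerD h1 h2).
have -> : \sum_(p <- P) a p / om p * (\sum_(k <- K) om k * c k * b (k - p)) =
   \sum_(k <- K) \sum_(p <- P) a p / om p * (om k * c k * b (k - p)).
  rewrite exchange_big /=; apply: eq_bigr => p _; exact: mulr_sumr.
rewrite -big_split; apply: ler_sum => k _ /=.
rewrite mulr_sumr -big_split; apply: ler_sum => p _ /=.
have -> : a p / om p * (om k * c k * b (k - p)) =
  (om k / om p) * (a p * c k * b (k - p)) by ring.
have -> : c k / om k * (om p * a p * b (k - p)) =
  (om p / om k) * (a p * c k * b (k - p)) by ring.
(* One of om_k / om_p and om_p / om_k is at least 1, so the sum of the two splittings dominates each
   term and the index set need not be cut along |p| <= |k|. *)
rewrite -mulrDl ler_peMl ?mulr_ge0 //.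
have [le|lt] := leP (om p) (om k).
  have : 1 <= om k / om p by rewrite ler_pdivlMr // mul1r.
  have : 0 <= om p / om k by rewrite divr_ge0 // ltW.
  lra.
have : 1 <= om p / om k by rewrite ler_pdivlMr // mul1r ltW.
have : 0 <= om k / om p by rewrite divr_ge0 // ltW.
lra.
Qed.

End Trilinear.

(** * Fields and their norms *)

Section Fields.
Context {R : realType}.
Implicit Types (u v w W : field R) (k p q : idx) (g om : idx -> R).

Definition vdot (w z : vec R) : R :=
  w.1.1 * z.1.1 + w.1.2 * z.1.2 + w.2.1 * z.2.1 + w.2.2 * z.2.2.
Definition vn (w : vec R) : R := Num.sqrt (vnorm2 w).
Definition kn k : R := Num.sqrt (ksq R k).

Lemma vnorm2_ge0 (w : vec R) : 0 <= vnorm2 w.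
Proof. by rewrite !addr_ge0 // sqr_ge0. Qed.

Lemma vn_ge0 (w : vec R) : 0 <= vn w. Proof. exact: sqrtr_ge0. Qed.

Lemma sqr_vn (w : vec R) : vn w ^+ 2 = vnorm2 w.
Proof. by rewrite sqr_sqrtr // vnorm2_ge0. Qed.

Lemma kn_ge0 k : 0 <= kn k. Proof. exact: sqrtr_ge0. Qed.

Lemma sqr_kn k : kn k ^+ 2 = ksq R k.
Proof. by rewrite sqr_sqrtr // ksq_ge0. Qed.

Lemma vdotvv (w : vec R) : vdot w w = vnorm2 w.
Proof. by rewrite /vdot /vnorm2 /cnorm2; ring. Qed.

Lemma normr_vdot_le (w z : vec R) : `|vdot w z| <= vn w * vn z.
Proof.
have h (x y : vec R) : vdot x y <= vn x * vn y.
  apply: ler_of_sqr; first by rewrite mulr_ge0 ?vn_ge0.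
  rewrite exprMn !sqr_vn /vdot /vnorm2 /cnorm2.
  move: x y => [[a b] [c d]] [[a' b'] [c' d']] /=.
  rewrite -subr_ge0.
  have -> : (a ^+ 2 + b ^+ 2 + (c ^+ 2 + d ^+ 2)) *
     (a' ^+ 2 + b' ^+ 2 + (c' ^+ 2 + d' ^+ 2)) -
     (a * a' + b * b' + c * c' + d * d') ^+ 2 =
    (a * b' - b * a') ^+ 2 + (a * c' - c * a') ^+ 2 + (a * d' - d * a') ^+ 2 +
    (b * c' - c * b') ^+ 2 + (b * d' - d * b') ^+ 2 + (c * d' - d * c') ^+ 2.
    by ring.
  by rewrite !addr_ge0 // sqr_ge0.
rewrite ler_norml h andbT -[vdot w z]opprK lerN2.
have -> : - vdot w z = vdot w (vscale (-1) z).
  by rewrite /vdot /vscale /Defs.cscale /=; ring.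
suff <- : vn (vscale (-1) z) = vn z by exact: h.
by rewrite /vn; congr Num.sqrt; rewrite /vnorm2 /cnorm2 /=; ring.
Qed.

Lemma vdotDl (a b z : vec R) : vdot (vadd a b) z = vdot a z + vdot b z.
Proof. by rewrite /vdot /vadd /Defs.cadd /=; ring. Qed.

Lemma vdotDr (a b z : vec R) : vdot z (vadd a b) = vdot z a + vdot z b.
Proof. by rewrite /vdot /vadd /Defs.cadd /=; ring. Qed.

Lemma vdotZr r (a z : vec R) : vdot z (vscale r a) = r * vdot z a.
Proof. by rewrite /vdot /vscale /Defs.cscale /=; ring. Qed.

Lemma vdotBr (a b z : vec R) : vdot z (vsub a b) = vdot z a - vdot z b.
Proof. by rewrite /vsub vdotDr vdotZr mulN1r. Qed.

Lemma vnorm2D (a b : vec R) :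
  vnorm2 (vadd a b) = vnorm2 a + 2 * vdot a b + vnorm2 b.
Proof. by rewrite /vnorm2 /cnorm2 /vdot /vadd /Defs.cadd /=; ring. Qed.

Lemma vnorm2Z r (a : vec R) : vnorm2 (vscale r a) = r ^+ 2 * vnorm2 a.
Proof. by rewrite /vnorm2 /cnorm2 /vscale /Defs.cscale /=; ring. Qed.

Lemma sumZ2_ub g (s : seq idx) : (forall k, 0 <= g k) -> (sumZ2 g < +oo)%E ->
  uniq s -> \sum_(k <- s) g k <= fine (sumZ2 g).
Proof.
move=> g0 fin us; rewrite -lee_fin fineK; last first.
  by rewrite ge0_fin_numE // esum_ge0 // => k _; rewrite lee_fin.
apply: esum_ge; exists [set` s]%classic; first by split=> //; exact: finite_seq.
by rewrite -fsbig_seq // sumEFin.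
Qed.

(** The passage from finite lists to the full lattice: estimates are proved on lists, and this
    yields both summability and the bound on the norm. *)
Lemma sumZ2_lub g C : (forall k, 0 <= g k) ->
  (forall s, uniq s -> \sum_(k <- s) g k <= C) ->
  (sumZ2 g < +oo)%E /\ fine (sumZ2 g) <= C.
Proof.
move=> g0 h; have le : (sumZ2 g <= C%:E)%E.
  apply: ge_ereal_sup => _ [A [fA _] <-].
  rewrite fsbig_finite //= sumEFin lee_fin.
  by apply: h; exact: finmap.fset_uniq.
have fin : (sumZ2 g < +oo)%E by apply: le_lt_trans le _; rewrite ltry.
split=> //; rewrite -lee_fin fineK // ge0_fin_numE // esum_ge0 // => k _.
by rewrite lee_fin.
Qed.

Lemma sumZ2_ge0 g : (forall k, 0 <= g k) -> 0 <= fine (sumZ2 g).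
Proof. by move=> g0; rewrite fine_ge0 // esum_ge0 // => k _; rewrite lee_fin. Qed.

Definition S0 u : R := fine (sumZ2 (fun k => vnorm2 (u k))).
Definition S1 u : R := fine (sumZ2 (fun k => ksq R k * vnorm2 (u k))).
Definition nH u : R := Num.sqrt (S0 u).
Definition nV u : R := Num.sqrt (S1 u).

Lemma kvnorm2_ge0 k (w : vec R) : 0 <= ksq R k * vnorm2 w.
Proof. by rewrite mulr_ge0 ?ksq_ge0 ?vnorm2_ge0. Qed.

Lemma S0_ge0 u : 0 <= S0 u.
Proof. by apply: sumZ2_ge0 => k; exact: vnorm2_ge0. Qed.
Lemma S1_ge0 u : 0 <= S1 u.
Proof. by apply: sumZ2_ge0 => k; exact: kvnorm2_ge0. Qed.
Lemma nH_ge0 u : 0 <= nH u. Proof. exact: sqrtr_ge0. Qed.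
Lemma nV_ge0 u : 0 <= nV u. Proof. exact: sqrtr_ge0. Qed.
Lemma sqr_nH u : nH u ^+ 2 = S0 u. Proof. by rewrite sqr_sqrtr // S0_ge0. Qed.
Lemma sqr_nV u : nV u ^+ 2 = S1 u. Proof. by rewrite sqr_sqrtr // S1_ge0. Qed.

(** A weighted l^2 bound expressed through finite sums, hence meaningful before summability is
    known. The weights used are 1, |k|^2 and M^2 + |k|^2. *)
Definition bnd om u (A : R) := forall s, uniq s ->
  \sum_(k <- s) om k * vnorm2 (u k) <= A ^+ 2.

Lemma bnd_fadd om u v A B : (forall k, 0 <= om k) -> 0 <= A -> 0 <= B ->
  bnd om u A -> bnd om v B -> bnd om (fadd u v) (A + B).
Proof.
move=> om0 A0 B0 hu hv s us.
have cs : \sum_(k <- s) om k * vdot (u k) (v k) <= A * B.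
  apply: (@le_trans _ _ (\sum_(k <- s)
      (Num.sqrt (om k) * vn (u k)) * (Num.sqrt (om k) * vn (v k)))).
    apply: ler_sum => k _.
    have -> : Num.sqrt (om k) * vn (u k) * (Num.sqrt (om k) * vn (v k)) =
       Num.sqrt (om k) ^+ 2 * (vn (u k) * vn (v k)) by ring.
    rewrite sqr_sqrtr //; apply: ler_wpM2l => //.
    exact: le_trans (ler_norm _) (normr_vdot_le _ _).
  apply: sum_CauchySchwarz => //.
    by under eq_bigr do rewrite exprMn sqr_vn sqr_sqrtr //; exact: hu.
  by under eq_bigr do rewrite exprMn sqr_vn sqr_sqrtr //; exact: hv.
have -> : \sum_(k <- s) om k * vnorm2 (fadd u v k) =
    \sum_(k <- s) om k * vnorm2 (u k) +
    2 * (\sum_(k <- s) om k * vdot (u k) (v k)) +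
    \sum_(k <- s) om k * vnorm2 (v k).
  rewrite mulr_sumr -!big_split /=; apply: eq_bigr => k _.
  by rewrite /fadd vnorm2D; ring.
have := hu _ us; have := hv _ us; lra.
Qed.

Lemma bnd_fscale om u r A : bnd om u A -> bnd om (fscale r u) (r * A).
Proof.
move=> hu s us; rewrite exprMn.
under eq_bigr do rewrite /fscale vnorm2Z mulrCA.
by rewrite -mulr_sumr ler_wpM2l ?sqr_ge0 //; exact: hu.
Qed.

Lemma bndN om u A : bnd om u A -> bnd om (fscale (-1) u) A.
Proof. by move/(@bnd_fscale _ _ (-1)); rewrite mulN1r /bnd sqrrN. Qed.

Lemma bnd_fsub om u v A B : (forall k, 0 <= om k) -> 0 <= A -> 0 <= B ->
  bnd om u A -> bnd om v B -> bnd om (fsub u v) (A + B).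
Proof. by move=> ? ? ? hu /bndN; exact: bnd_fadd. Qed.

Lemma inH_bnd u : inH u -> bnd (fun=> 1) u (nH u).
Proof.
case=> _ _ _ fin s us; under eq_bigr do rewrite mul1r.
by rewrite sqr_nH; apply: sumZ2_ub => // k; exact: vnorm2_ge0.
Qed.

Lemma bnd_nH u A : 0 <= A -> bnd (fun=> 1) u A ->
  (sumZ2 (fun k => vnorm2 (u k)) < +oo)%E /\ nH u <= A.
Proof.
move=> A0 h.
have := @sumZ2_lub (fun k => vnorm2 (u k)) (A ^+ 2) (fun k => vnorm2_ge0 _).
case=> [s us|? le]; first by under eq_bigr do rewrite -[vnorm2 _]mul1r; exact: h.
by split=> //; apply: ler_of_sqr => //; rewrite sqr_nH.
Qed.

Lemma inV_bnd u : inV u -> bnd (ksq R) u (nV u).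
Proof.
case=> _ fin s us.
by rewrite sqr_nV; apply: sumZ2_ub => // k; exact: kvnorm2_ge0.
Qed.

Lemma bnd_nV u A : 0 <= A -> bnd (ksq R) u A ->
  (sumZ2 (fun k => (ksq R k * vnorm2 (u k))%R) < +oo)%E /\ nV u <= A.
Proof.
move=> A0 h.
have := @sumZ2_lub (fun k => ksq R k * vnorm2 (u k)) (A ^+ 2)
  (fun k => kvnorm2_ge0 _ _) h.
by case=> ? le; split=> //; apply: ler_of_sqr => //; rewrite sqr_nV.
Qed.

Let one_ge0 k : 0 <= 1 :> R := ler01.

Lemma inH_fadd u v : inH u -> inH v -> inH (fadd u v).
Proof.
move=> hu hv; have bu := inH_bnd hu; have bv := inH_bnd hv.
case: hu hv => [u0 uc ud _] [v0 vc vd _]; split.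
- by rewrite /fadd u0 v0; congr ((_, _), (_, _)); exact: addr0.
- by move=> k; rewrite /fadd uc vc /vadd /vconj /cconj /Defs.cadd /= !opprD.
- move=> k; rewrite /fadd.
  move: (ud k) (vd k); rewrite /kdot /Defs.cadd /Defs.cscale /vadd /c0 /=.
  case=> a b [c d]; congr (_, _); lra.
- have h := bnd_fadd one_ge0 (nH_ge0 u) (nH_ge0 v) bu bv.
  by case: (bnd_nH _ h); rewrite ?addr_ge0 ?nH_ge0.
Qed.

Lemma inH_fscale r u : inH u -> inH (fscale r u).
Proof.
move=> hu; have bu := inH_bnd hu; case: hu => [u0 uc ud _]; split.
- by rewrite /fscale u0; congr ((_, _), (_, _)); exact: mulr0.
- by move=> k; rewrite /fscale uc; congr ((_, _), (_, _)); exact: mulrN.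
- move=> k; rewrite /fscale; move: (ud k).
  rewrite /kdot /Defs.cadd /Defs.cscale /vscale /c0 /= => -[a b]; congr (_, _).
    by rewrite -[RHS](mulr0 r) -a; ring.
  by rewrite -[RHS](mulr0 r) -b; ring.
- have h' : bnd (fun=> 1) (fscale r u) (`|r| * nH u).
    move=> s us; rewrite exprMn real_normK ?num_real // -exprMn.
    exact: bnd_fscale.
  by case: (bnd_nH _ h'); rewrite ?mulr_ge0 ?nH_ge0.
Qed.

Lemma inH_fsub u v : inH u -> inH v -> inH (fsub u v).
Proof. by move=> hu hv; apply: (inH_fadd hu); exact: (inH_fscale (-1)). Qed.

Lemma inV_fadd u v : inV u -> inV v -> inV (fadd u v).
Proof.
move=> hu hv; have := bnd_fadd (@ksq_ge0 R) (nV_ge0 u) (nV_ge0 v)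
  (inV_bnd hu) (inV_bnd hv).
move/bnd_nV => h; split; first by apply: inH_fadd; [case: hu|case: hv].
by case: h; rewrite ?addr_ge0 ?nV_ge0.
Qed.

Lemma inV_fsub u v : inV u -> inV v -> inV (fsub u v).
Proof.
move=> hu hv; have := bnd_fsub (@ksq_ge0 R) (nV_ge0 u) (nV_ge0 v)
  (inV_bnd hu) (inV_bnd hv).
move/bnd_nV => h; split; first by apply: inH_fsub; [case: hu|case: hv].
by case: h; rewrite ?addr_ge0 ?nV_ge0.
Qed.

Lemma nV_fadd u v : inV u -> inV v -> nV (fadd u v) <= nV u + nV v.
Proof.
move=> hu hv; have := bnd_fadd (@ksq_ge0 R) (nV_ge0 u) (nV_ge0 v)
  (inV_bnd hu) (inV_bnd hv).
by case/bnd_nV; rewrite ?addr_ge0 ?nV_ge0.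
Qed.

Lemma nV_fsub u v : inV u -> inV v -> nV (fsub u v) <= nV u + nV v.
Proof.
move=> hu hv; have := bnd_fsub (@ksq_ge0 R) (nV_ge0 u) (nV_ge0 v)
  (inV_bnd hu) (inV_bnd hv).
by case/bnd_nV; rewrite ?addr_ge0 ?nV_ge0.
Qed.

Lemma nH_fadd u v : inH u -> inH v -> nH (fadd u v) <= nH u + nH v.
Proof.
move=> hu hv; have := bnd_fadd one_ge0 (nH_ge0 u) (nH_ge0 v)
  (inH_bnd hu) (inH_bnd hv).
by case/bnd_nH; rewrite ?addr_ge0 ?nH_ge0.
Qed.

Lemma ksq_ge1 k : k != k0 -> 1 <= ksq R k.
Proof.
case: k => a b h; rewrite /ksq /kx /ky /=.
have -> : a%:~R ^+ 2 + b%:~R ^+ 2 = (a ^+ 2 + b ^+ 2)%:~R :> R.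
  by rewrite rmorphD /= !rmorphXn.
rewrite ler1z.
have /orP[a0|b0] : (a != 0) || (b != 0).
  rewrite -negb_and; apply: contra h => /andP[/eqP -> /eqP ->]; exact: eqxx.
- have := sqr_ge0 b; have : 0 < a ^+ 2 by rewrite exprn_even_gt0.
  lia.
- have := sqr_ge0 a; have : 0 < b ^+ 2 by rewrite exprn_even_gt0.
  lia.
Qed.

Lemma vnorm20 : vnorm2 (vec0 R) = 0.
Proof. by rewrite /vnorm2 /cnorm2 /= expr0n /= !addr0. Qed.

(** Poincare's inequality, with constant 1 because the mean vanishes and |k| >= 1 for every other
    mode. *)
Lemma nH_le_nV u : inV u -> nH u <= nV u.
Proof.
move=> hu; have [[u0 _ _ _] _] := hu.
apply: (bnd_nH (nV_ge0 u) _).2 => s us; apply: le_trans (inV_bnd hu us).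
apply: ler_sum => k _.
have [->|/ksq_ge1 k1] := eqVneq k k0; first by rewrite u0 vnorm20 !mulr0.
by rewrite ler_wpM2r // vnorm2_ge0.
Qed.

Lemma S0_le_S1 u : inV u -> S0 u <= S1 u.
Proof.
move=> hu; rewrite -(sqr_nH u) -(sqr_nV u).
by apply: lerXn2r (nH_le_nV hu); [exact: nH_ge0 | exact: nV_ge0].
Qed.

End Fields.

(** * The bilinear term as a limit of box sums *)

Section Bilinear.
Context {R : realType}.
Implicit Types (u v w W : field R) (k p q : idx).

Lemma cvgn_sum (I : Type) (s : seq I) (f : I -> nat -> R) (l : I -> R) :
  (forall i, f i n @[n --> \oo] --> l i)%classic ->
  (\sum_(i <- s) f i n @[n --> \oo] --> \sum_(i <- s) l i)%classic.
Proof.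
move=> h; elim: s => [|i s IH].
  rewrite big_nil (_ : (fun=> _) = fun=> 0); first exact: cvg_cst.
  by apply/funext => n; rewrite big_nil.
rewrite big_cons (_ : (fun=> _) = fun n => f i n + \sum_(i <- s) f i n).
  exact: cvgD.
by apply/funext => n; rewrite big_cons.
Qed.

Lemma cvgn_norm_le (x : nat -> R) (l C : R) (n0 : nat) :
  (x n @[n --> \oo] --> l)%classic ->
  (forall n, (n0 <= n)%N -> `|x n| <= C) -> `|l| <= C.
Proof.
move=> xl hC; apply/ler_addgt0Pr => e e0.
have /cvgrPdist_lt /(_ e e0) [m _ hm] := xl.
have h1 := hC (n0 + m)%N (leq_addr _ _).
have h2 : `|l - x (n0 + m)%N| < e by apply: hm; rewrite /= leq_addl.
have -> : l = x (n0 + m)%N + (l - x (n0 + m)%N) by ring.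
apply: le_trans (ler_normD _ _) _; apply: lerD => //; exact: ltW.
Qed.

Lemma sum_bx_cvg (h : idx -> R) (C : R) :
  (forall s, uniq s -> \sum_(k <- s) `|h k| <= C) ->
  cvgn (fun n => \sum_(k <- bx n) h k).
Proof.
move=> hC.
have pos (g : idx -> R) : (forall k, 0 <= g k <= `|h k|) ->
    cvgn (fun n => \sum_(k <- bx n) g k).
  move=> hg; apply: nondecreasing_is_cvgn.
    move=> m n mn; apply: ler_sum_seq_sub; [exact: bx_uniq|exact: bx_sub|].
    by move=> k; case/andP: (hg k).
  exists C => _ [n _ <-]; apply: le_trans (hC _ (bx_uniq n)).
  by apply: ler_sum => k _; case/andP: (hg k).
rewrite (_ : (fun n => _) = (fun n => \sum_(k <- bx n) (`|h k| + h k) / 2 -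
    \sum_(k <- bx n) (`|h k| - h k) / 2)).
  apply: is_cvgB; apply: pos => k.
    have := ler_norm (h k); have := lerNnormlW (lexx `|h k|); lra.
  have := ler_norm (h k); have := lerNnormlW (lexx `|h k|); lra.
apply/funext => n; rewrite -sumrB; apply: eq_bigr => k _; lra.
Qed.

(** Up to the factor i, this is what the pair of modes (p, k - p) contributes to the k-th
    coefficient of (u.grad) v. In [tau] it is paired with W_k without the Leray projection, which is
    invisible to a divergence-free W. *)
Definition cterm u v k p : vec R := cvmul (kdot (k - p) (u p)) (v (k - p)).
Definition tau u v W k p : R := vdot (W k) (vmulI (cterm u v k p)).

Lemma conv_partE u v k n : conv_part u v k n = \sum_(p <- bx n) cterm u v k p.
Proof. by rewrite sum_bx. Qed.

Lemma vn_cterm u v k p :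
  vn (cterm u v k p) <= vn (u p) * (kn (k - p) * vn (v (k - p))).
Proof.
apply: ler_of_sqr; first by rewrite !mulr_ge0 ?vn_ge0 ?kn_ge0.
rewrite !exprMn !sqr_vn sqr_kn /cterm; move: (k - p) => q.
have -> : vnorm2 (cvmul (kdot q (u p)) (v q)) =
    cnorm2 (kdot q (u p)) * vnorm2 (v q).
  by rewrite /vnorm2 /cnorm2 /cvmul /cmul /=; ring.
rewrite mulrA; apply: ler_wpM2r; first exact: vnorm2_ge0.
rewrite mulrC /cnorm2 /kdot /Defs.cadd /Defs.cscale /ksq /vnorm2 /cnorm2 /=.
move: (u p) (kx R q) (ky R q) => [[a b] [c d]] x y /=.
have := sqr_ge0 (x * c - y * a); have := sqr_ge0 (x * d - y * b); lra.
Qed.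

Lemma vn_vmulI (w : vec R) : vn (vmulI w) = vn w.
Proof. by congr Num.sqrt; rewrite /vnorm2 /cnorm2 /vmulI /cmulI /=; ring. Qed.

Lemma normr_tau_le u v W k p :
  `|tau u v W k p| <= vn (u p) * vn (W k) * (kn (k - p) * vn (v (k - p))).
Proof.
apply: le_trans (normr_vdot_le _ _) _; rewrite vn_vmulI mulrAC mulrC.
by apply: ler_wpM2r; [exact: vn_ge0|exact: vn_cterm].
Qed.

Lemma tau_sum_le (M A B C : R) u v W (K P : seq idx) :
  1 <= M -> 0 <= A -> 0 <= B -> 0 <= C -> uniq K -> uniq P ->
  bnd (fun k => M ^+ 2 + ksq R k) u A -> bnd (ksq R) v B ->
  bnd (fun k => M ^+ 2 + ksq R k) W C ->
  `|\sum_(k <- K) \sum_(p <- P) tau u v W k p| <= 10 / M * (A * C * B).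
Proof.
move=> M1 A0 B0 C0 uK uP hu hv hW.
apply: (@le_trans _ _ (\sum_(k <- K) \sum_(p <- P)
    vn (u p) * vn (W k) * (kn (k - p) * vn (v (k - p))))).
  apply: le_trans (ler_norm_sum _ _ _) _; apply: ler_sum => k _.
  apply: le_trans (ler_norm_sum _ _ _) _; apply: ler_sum => p _.
  exact: normr_tau_le.
apply: (@trilinear_le _ M (fun p => vn (u p)) (fun q => kn q * vn (v q))
  (fun k => vn (W k))) => //.
- by move=> k; exact: vn_ge0.
- by move=> k; rewrite mulr_ge0 ?vn_ge0 ?kn_ge0.
- by move=> k; exact: vn_ge0.
- by under eq_bigr do rewrite sqr_vn; exact: hu.
- by move=> t ut; under eq_bigr do rewrite exprMn sqr_vn sqr_kn; exact: hv.
- by under eq_bigr do rewrite sqr_vn; exact: hW.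
Qed.

Lemma cterm_sum_le u v k (s : seq idx) : inV u -> inV v -> uniq s ->
  \sum_(p <- s) vn (cterm u v k p) <= nH u * nV v.
Proof.
move=> hu hv us.
apply: (@le_trans _ _ (\sum_(p <- s) vn (u p) * (kn (k - p) * vn (v (k - p))))).
  by apply: ler_sum => p _; exact: vn_cterm.
apply: (@sum_conv_le _ (fun q => kn q * vn (v q)) (fun p => vn (u p))
  k s _ _ (nV_ge0 v) (nH_ge0 u) us).
  by move=> t ut; under eq_bigr do rewrite exprMn sqr_vn sqr_kn; exact: inV_bnd.
under eq_bigr do rewrite sqr_vn -[vnorm2 _]mul1r.
by case: hu => /inH_bnd h _; exact: h.
Qed.

Lemma conv_part_cvg u v k (f : {additive vec R -> R}) : inV u -> inV v ->
  (forall w : vec R, `|f w| <= vn w) -> cvgn (fun n => f (conv_part u v k n)).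
Proof.
move=> hu hv fn; rewrite (_ : (fun n => _) =
    fun n => \sum_(p <- bx n) f (cterm u v k p)).
  apply: (@sum_bx_cvg _ (nH u * nV v)) => s us.
  apply: le_trans (cterm_sum_le k hu hv us).
  by apply: ler_sum => p _; exact: fn.
by apply/funext => n; rewrite conv_partE raddf_sum.
Qed.

Lemma normr_le_vn (x : R) (w : vec R) : x ^+ 2 <= vnorm2 w -> `|x| <= vn w.
Proof.
by move=> h; apply: ler_of_sqr; rewrite ?vn_ge0 // real_normK ?num_real // sqr_vn.
Qed.

(** [seqlim] is a total function with a meaningless value on divergent sequences; absolute
    convergence of the convolution shows that [bilB] is built from true limits. *)
Lemma vlim_cvg u v k : inV u -> inV v -> let L := vlim (conv_part u v k) in
  [/\ ((conv_part u v k n).1.1 @[n --> \oo] --> L.1.1)%classic,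
      ((conv_part u v k n).1.2 @[n --> \oo] --> L.1.2)%classic,
      ((conv_part u v k n).2.1 @[n --> \oo] --> L.2.1)%classic &
      ((conv_part u v k n).2.2 @[n --> \oo] --> L.2.2)%classic].
Proof.
move=> hu hv /=; have sq := @sqr_ge0 R.
split.
- apply: (@conv_part_cvg u v k (fst \o fst)) => //.
  move=> w; apply: normr_le_vn; rewrite /vnorm2 /cnorm2 /=.
  have := sq w.1.2; have := sq w.2.1; have := sq w.2.2; lra.
- apply: (@conv_part_cvg u v k (snd \o fst)) => //.
  move=> w; apply: normr_le_vn; rewrite /vnorm2 /cnorm2 /=.
  have := sq w.1.1; have := sq w.2.1; have := sq w.2.2; lra.
- apply: (@conv_part_cvg u v k (fst \o snd)) => //.
  move=> w; apply: normr_le_vn; rewrite /vnorm2 /cnorm2 /=.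
  have := sq w.1.2; have := sq w.1.1; have := sq w.2.2; lra.
- apply: (@conv_part_cvg u v k (snd \o snd)) => //.
  move=> w; apply: normr_le_vn; rewrite /vnorm2 /cnorm2 /=.
  have := sq w.1.2; have := sq w.2.1; have := sq w.1.1; lra.
Qed.

(** The part removed by the projection is parallel to k, and k . w = 0 makes it orthogonal to w. *)
Lemma vdot_leray k (w z : vec R) : kdot k w = c0 R ->
  vdot w (leray k z) = vdot w z.
Proof.
rewrite /kdot /Defs.cadd /Defs.cscale => -[h1 h2]; rewrite /leray vdotBr.
suff -> : vdot w (Defs.cscale (kx R k / ksq R k) (kdot k z),
     Defs.cscale (ky R k / ksq R k) (kdot k z)) = 0 by rewrite subr0.
rewrite /vdot; case: (kdot k z) => a b; rewrite /Defs.cscale /=.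
transitivity ((kx R k * w.1.1 + ky R k * w.2.1) * a / ksq R k +
   (kx R k * w.1.2 + ky R k * w.2.2) * b / ksq R k); first by ring.
by rewrite h1 h2 !mul0r addr0.
Qed.

Lemma vmulID (a b : vec R) : vmulI (a + b) = vmulI a + vmulI b.
Proof. by rewrite /vmulI /cmulI /=; congr ((_, _), (_, _)); exact: opprD. Qed.

Lemma tau_sum u v W k (P : seq idx) :
  \sum_(p <- P) tau u v W k p = vdot (W k) (vmulI (\sum_(p <- P) cterm u v k p)).
Proof.
elim: P => [|p P IH].
  by rewrite !big_nil /vdot /vmulI /cmulI /= !oppr0 !mulr0 !addr0.
by rewrite !big_cons IH vmulID vdotDr.
Qed.

Lemma tau_cvg u v W k : inV u -> inV v -> inV W ->
  (\sum_(p <- bx n) tau u v W k p @[n --> \oo] -->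
     vdot (W k) (bilB u v k))%classic.
Proof.
move=> hu hv [[W0 _ Wd _] _]; rewrite /bilB.
case: eqVneq => [->|k0].
  rewrite (_ : (fun n => _) = fun=> vdot (W k0) (vec0 R)); first exact: cvg_cst.
  by apply/funext => n; rewrite tau_sum W0 /vdot /= !mul0r.
rewrite vdot_leray //.
rewrite (_ : (fun n => _) = fun n => vdot (W k) (vmulI (conv_part u v k n))).
  have [c1 c2 c3 c4] := vlim_cvg k hu hv.
  rewrite /vdot /vmulI /cmulI /=.
  by do !apply: cvgD; apply: cvgM => //; try exact: cvg_cst; exact: cvgN.
by apply/funext => n; rewrite tau_sum conv_partE.
Qed.

End Bilinear.

(** * The trilinear form *)

Section TrilinearForm.
Context {R : realType}.
Implicit Types (u v w W : field R) (k p q : idx).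

(** Only the output mode k is truncated; the convolution inside [bilB] is complete. No convergence
    of the sum over k is thus required. *)
Definition B3 (K : nat) u v W : R := \sum_(k <- bx K) vdot (W k) (bilB u v k).

Lemma B3_cvg K u v W : inV u -> inV v -> inV W ->
  (\sum_(k <- bx K) \sum_(p <- bx n) tau u v W k p @[n --> \oo] -->
     B3 K u v W)%classic.
Proof. by move=> hu hv hW; apply: cvgn_sum => k; exact: tau_cvg. Qed.

Lemma bnd_quad M u : inV u ->
  bnd (fun k => M ^+ 2 + ksq R k) u (Num.sqrt (M ^+ 2 * S0 u + S1 u)).
Proof.
move=> hu s us; rewrite sqr_sqrtr; last first.
  by rewrite addr_ge0 ?S1_ge0 // mulr_ge0 ?sqr_ge0 ?S0_ge0.
under eq_bigr do rewrite mulrDl.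
rewrite big_split /=; apply: lerD; last by rewrite -sqr_nV; exact: inV_bnd.
rewrite -mulr_sumr ler_wpM2l ?sqr_ge0 //.
have [/inH_bnd h _] := hu; move: (h _ us); rewrite sqr_nH.
by under eq_bigr do rewrite mul1r.
Qed.

Lemma normr_B3_le M K u v W : 1 <= M -> inV u -> inV v -> inV W ->
  `|B3 K u v W| <= 10 / M * (Num.sqrt (M ^+ 2 * S0 u + S1 u) *
     Num.sqrt (M ^+ 2 * S0 W + S1 W) * nV v).
Proof.
move=> M1 hu hv hW; apply: (@cvgn_norm_le _ _ _ _ 0%N (B3_cvg (K := K) hu hv hW)) => n _.
apply: tau_sum_le => //; rewrite ?bx_uniq ?sqrtr_ge0 //.
- exact: bnd_quad.
- exact: inV_bnd.
- exact: bnd_quad.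
Qed.

Lemma sqrt_quad1_le u : inV u -> Num.sqrt (1 ^+ 2 * S0 u + S1 u) <= 2 * nV u.
Proof.
move=> hu; apply: ler_of_sqr; first by rewrite mulr_ge0 ?nV_ge0.
rewrite exprMn sqr_nV sqr_sqrtr; last first.
  by rewrite expr1n mul1r; exact: addr_ge0 (S0_ge0 u) (S1_ge0 u).
have := S0_le_S1 hu; have := S1_ge0 u; lra.
Qed.

(** Continuity of the trilinear form on V, uniformly in the box: M = 1 and Poincare's inequality
    suffice here, because this bound only serves to estimate errors that vanish with the time
    step. *)
Lemma normr_B3_leV K u v W : inV u -> inV v -> inV W ->
  `|B3 K u v W| <= 40 * (nV u * nV W * nV v).
Proof.
move=> hu hv hW; apply: le_trans (normr_B3_le K (lexx 1) hu hv hW) _.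
have -> : 40 * (nV u * nV W * nV v) =
    10 / 1 * ((2 * nV u) * (2 * nV W) * nV v) by field.
rewrite ler_wpM2l // ler_wpM2r ?nV_ge0 //.
by apply: ler_pM; rewrite ?sqrtr_ge0 ?sqrt_quad1_le.
Qed.

Lemma normr_B3_leM M K w v : 1 <= M -> inV w -> inV v ->
  `|B3 K w v w| <= 10 * ((M * S0 w + S1 w / M) * nV v).
Proof.
move=> M1 hw hv; have M0 : 0 < M by lra.
apply: le_trans (normr_B3_le K M1 hw hv hw) _.
rewrite -expr2 sqr_sqrtr; last first.
  by rewrite addr_ge0 ?S1_ge0 // mulr_ge0 ?sqr_ge0 ?S0_ge0.
rewrite le_eqVlt; apply/orP; left; apply/eqP; field; by rewrite gt_eqF.
Qed.

Lemma cterm_fadd_l u u' v k p :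
  cterm (fadd u u') v k p = cterm u v k p + cterm u' v k p.
Proof.
rewrite /cterm /fadd; move: (u p) (u' p) (v (k - p)) => a b c.
by rewrite /cvmul /cmul /kdot /vadd /Defs.cadd /Defs.cscale /=;
  congr ((_, _), (_, _)); rewrite /=; ring.
Qed.

Lemma cterm_fadd_r u v v' k p :
  cterm u (fadd v v') k p = cterm u v k p + cterm u v' k p.
Proof.
rewrite /cterm /fadd; move: (kdot (k - p) (u p)) (v (k - p)) (v' (k - p)).
move=> a b c; rewrite /cvmul /cmul /vadd /Defs.cadd /=.
by congr ((_, _), (_, _)); rewrite /=; ring.
Qed.

(** [bilB] is defined by limits, so additivity comes from uniqueness of the limit of the sums of
    [tau]. *)
Lemma vdot_bilB_fadd_l u u' v W k : inV u -> inV u' -> inV v -> inV W ->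
  vdot (W k) (bilB (fadd u u') v k) =
  vdot (W k) (bilB u v k) + vdot (W k) (bilB u' v k).
Proof.
move=> hu hu' hv hW; have h1 := tau_cvg (k := k) (inV_fadd hu hu') hv hW.
have h2 := cvgD (tau_cvg (k := k) hu hv hW) (tau_cvg (k := k) hu' hv hW).
suff E : (fun n => \sum_(p <- bx n) tau (fadd u u') v W k p) =
    (fun n => \sum_(p <- bx n) tau u v W k p) \+
    (fun n => \sum_(p <- bx n) tau u' v W k p).
  rewrite E in h1; rewrite -(cvg_lim (@Rhausdorff R) h1).
  by apply: cvg_lim; [exact: Rhausdorff | exact: h2].
apply/funext => n /=; rewrite -big_split; apply: eq_bigr => p _ /=.
by rewrite /tau cterm_fadd_l vmulID; exact: vdotDr.
Qed.

Lemma vdot_bilB_fadd_r u v v' W k : inV u -> inV v -> inV v' -> inV W ->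
  vdot (W k) (bilB u (fadd v v') k) =
  vdot (W k) (bilB u v k) + vdot (W k) (bilB u v' k).
Proof.
move=> hu hv hv' hW; have h1 := tau_cvg (k := k) hu (inV_fadd hv hv') hW.
have h2 := cvgD (tau_cvg (k := k) hu hv hW) (tau_cvg (k := k) hu hv' hW).
suff E : (fun n => \sum_(p <- bx n) tau u (fadd v v') W k p) =
    (fun n => \sum_(p <- bx n) tau u v W k p) \+
    (fun n => \sum_(p <- bx n) tau u v' W k p).
  rewrite E in h1; rewrite -(cvg_lim (@Rhausdorff R) h1).
  by apply: cvg_lim; [exact: Rhausdorff | exact: h2].
apply/funext => n /=; rewrite -big_split; apply: eq_bigr => p _ /=.
by rewrite /tau cterm_fadd_r vmulID; exact: vdotDr.
Qed.

Lemma B3_fadd_l K u u' v W : inV u -> inV u' -> inV v -> inV W ->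
  B3 K (fadd u u') v W = B3 K u v W + B3 K u' v W.
Proof.
move=> hu hu' hv hW; rewrite /B3 -big_split; apply: eq_bigr => k _.
exact: vdot_bilB_fadd_l.
Qed.

Lemma B3_fadd_r K u v v' W : inV u -> inV v -> inV v' -> inV W ->
  B3 K u (fadd v v') W = B3 K u v W + B3 K u v' W.
Proof.
move=> hu hv hv' hW; rewrite /B3 -big_split; apply: eq_bigr => k _.
exact: vdot_bilB_fadd_r.
Qed.

Lemma B3_fadd_W K u v W W' :
  B3 K u v (fadd W W') = B3 K u v W + B3 K u v W'.
Proof.
by rewrite /B3 -big_split; apply: eq_bigr => k _; rewrite vdotDl.
Qed.

(* The involution (k, q) -> (-q, -k) changes the sign of the summand, because
   (v_p . q) = (v_p . k) for p = k - q and w is real-valued. *)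
Lemma tau_skew v w k q : inV v -> inV w ->
  tau v w w (- q) (- q - - k) = - tau v w w k (k - q).
Proof.
move=> [[_ _ vd _] _] [[_ wc _ _] _].
have -> : - q - - k = k - q by rewrite opprK addrC.
rewrite /tau /cterm.
have -> : k - (k - q) = q by rewrite opprB addrC subrK.
have -> : - q - (k - q) = - k by rewrite opprB addrA addNr add0r.
have -> : kdot (- k) (v (k - q)) = (- (kdot q (v (k - q))).1, - (kdot q (v (k - q))).2).
  move: (vd (k - q)); rewrite /kdot /Defs.cadd /Defs.cscale /c0 /= => -[].
  rewrite /kx /ky -[(k - q).1]/(k.1 - q.1) -[(k - q).2]/(k.2 - q.2).
  rewrite -[(- k).1]/(- k.1) -[(- k).2]/(- k.2) !mulrNz !mulrzBr.
  move: (v (k - q)) => [[a b] [c d]] /= h1 h2; congr (_, _); lra.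
have -> : w (- q) = vconj (w q) by exact: wc.
have -> : w (- k) = vconj (w k) by exact: wc.
move: (kdot q (v (k - q))) (w k) (w q) => [a b] [[x y] [z t]] [[x' y'] [z' t']].
by rewrite /vdot /vmulI /cmulI /vconj /cconj /cvmul /cmul /=; ring.
Qed.

Lemma tau_box_sum0 v w K : inV v -> inV w ->
  \sum_(k <- bx K) \sum_(q <- bx K) tau v w w k (k - q) = 0.
Proof.
move=> hv hw; set S := LHS.
suff : S = - S by lra.
rewrite {1}/S -(perm_big _ (perm_bxN K)) big_map /=.
under eq_bigr do rewrite -(perm_big _ (perm_bxN K)) big_map /=.
rewrite exchange_big /= /S -sumrN; apply: eq_bigr => k _.
rewrite -sumrN; apply: eq_bigr => q _; exact: tau_skew.
Qed.

(** Truncating k alone leaves pairs (k, q), q = k - p, with q outside the box, and the involution of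
    [tau_skew] does not preserve that set. Cutting the differentiated argument to the same box
    restores a symmetric set, on which the cancellation is exact; the tail is small in V. *)
Definition head_field K w : field R := fun q => if q \in bx K then w q else vec0 R.
Definition tail_field K w : field R := fun q => if q \in bx K then vec0 R else w q.

Lemma head_tail_field K w : w = fadd (head_field K w) (tail_field K w).
Proof.
apply/funext => q; rewrite /fadd /head_field /tail_field.
case: ifP => _; case: (w q) => [[a b] [c d]]; congr ((_, _), (_, _));
  by rewrite /= ?addr0 ?add0r.
Qed.

(** The head forces q = k - p into the box of radius K. Once n >= 2 K, the inner box contains k - q
    for all k and q of that box, so reindexing by q gives the full symmetric sum. *)
Lemma tau_head_sum0 v w K n : inV v -> inV w -> (2 * K <= n)%N ->
  \sum_(k <- bx K) \sum_(p <- bx n) tau v (head_field K w) w k p = 0.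
Proof.
move=> hv hw Kn; rewrite -[RHS](tau_box_sum0 K hv hw).
rewrite big_seq [RHS]big_seq; apply: eq_bigr => k kK.
transitivity (\sum_(p <- bx n | k - p \in bx K) tau v w w k p).
  rewrite [RHS]big_mkcond /=; apply: eq_bigr => p _.
  rewrite /tau /cterm /head_field; case: ifP => // _.
  by rewrite /vdot /vmulI /cmulI /cvmul /cmul /= !(mulr0, subr0, addr0, oppr0).
rewrite -big_filter -[RHS](big_map (fun q => k - q) xpredT (fun p => tau v w w k p)).
apply: perm_big; apply: uniq_perm.
- by rewrite filter_uniq // bx_uniq.
- by rewrite map_inj_uniq ?bx_uniq // => x y /addrI /oppr_inj.
move=> p; rewrite mem_filter; apply/andP/mapP => [[h1 h2]|[q hq ->]].
  by exists (k - p) => //; rewrite opprB addrC subrK.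
have -> : k - (k - q) = q by rewrite opprB addrC subrK.
split=> //; move: kK hq; rewrite !mem_bx.
rewrite -[(k - q).1]/(k.1 - q.1) -[(k - q).2]/(k.2 - q.2).
by move: (k.1 : int) (k.2 : int) (q.1 : int) (q.2 : int) => a b c d; lia.
Qed.

Lemma bnd_tail K w : inV w -> bnd (ksq R) (tail_field K w)
  (Num.sqrt (S1 w - \sum_(k <- bx K) ksq R k * vnorm2 (w k))).
Proof.
move=> hw s us.
have h0 : 0 <= S1 w - \sum_(k <- bx K) ksq R k * vnorm2 (w k).
  by rewrite subr_ge0 -sqr_nV; apply: inV_bnd => //; exact: bx_uniq.
rewrite sqr_sqrtr // lerBrDr.
have -> : \sum_(k <- s) ksq R k * vnorm2 (tail_field K w k) =
    \sum_(k <- [seq k <- s | k \notin bx K]) ksq R k * vnorm2 (w k).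
  rewrite big_filter [RHS]big_mkcond /=; apply: eq_bigr => k _.
  by rewrite /tail_field; case: ifP => //= _; rewrite vnorm20 mulr0.
rewrite -big_cat -sqr_nV; apply: inV_bnd => //.
rewrite cat_uniq filter_uniq // bx_uniq andbT andTb.
by apply/hasPn => k kK; rewrite mem_filter kK.
Qed.

Lemma sum_bx_near (g : idx -> R) : (forall k, 0 <= g k) -> (sumZ2 g < +oo)%E ->
  forall e, 0 < e -> exists K0, forall K, (K0 <= K)%N ->
    fine (sumZ2 g) - e < \sum_(k <- bx K) g k.
Proof.
move=> g0 fin e e0.
have [//|h] := pselect (exists K0, forall K, (K0 <= K)%N ->
    fine (sumZ2 g) - e < \sum_(k <- bx K) g k).
have [] := @sumZ2_lub _ g (fine (sumZ2 g) - e) g0; last lra.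
move=> s us; have [n sn] := seq_sub_bx s; rewrite leNgt; apply/negP => lt.
apply: h; exists n => K nK; apply: lt_le_trans lt _.
by apply: ler_sum_seq_sub => // k /sn; exact: bx_sub.
Qed.

(** The identity (B(v,w),w) = 0 survives truncation in k only up to an error bounded by the V-tail
    of w. The threshold depends on v and w, so it will be applied at a single time. *)
Lemma B3_skew v w : inV v -> inV w -> forall e, 0 < e ->
  exists K0, forall K, (K0 <= K)%N -> `|B3 K v w w| <= e.
Proof.
move=> hv hw e e0.
set C := 10 / 1 * (Num.sqrt (1 ^+ 2 * S0 v + S1 v) *
     Num.sqrt (1 ^+ 2 * S0 w + S1 w)).
have C0 : 0 <= C by rewrite !mulr_ge0 ?sqrtr_ge0.
(* The 1 keeps the quotient meaningful when C = 0. *)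
have d0 : 0 < e / (C + 1) by rewrite divr_gt0 //; lra.
have [_ fin] := hw.
have [K0 hK] := sum_bx_near (fun k => kvnorm2_ge0 k (w k)) fin
  (exprn_gt0 2 d0).
exists K0 => K /hK; rewrite -/(S1 w).
set T := S1 w - \sum_(k <- bx K) ksq R k * vnorm2 (w k) => lt.
have sT : Num.sqrt T <= e / (C + 1).
  rewrite -[leRHS]ger0_norm; last exact: ltW.
  rewrite -sqrtr_sqr ler_wsqrtr // /T; lra.
apply: (@le_trans _ _ (C * Num.sqrt T)); last first.
  apply: le_trans (ler_wpM2l C0 sT) _.
  rewrite mulrA ler_pdivrMr; last by lra.
  rewrite mulrC; nra.
apply: (@cvgn_norm_le _ _ _ _ (2 * K)%N (B3_cvg (K := K) hv hw hw)) => n Kn.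
have -> : \sum_(k <- bx K) \sum_(p <- bx n) tau v w w k p =
    \sum_(k <- bx K) \sum_(p <- bx n) tau v (tail_field K w) w k p.
  transitivity (\sum_(k <- bx K) \sum_(p <- bx n) tau v (head_field K w) w k p +
    \sum_(k <- bx K) \sum_(p <- bx n) tau v (tail_field K w) w k p).
    rewrite -big_split /=; apply: eq_bigr => k _.
    rewrite -big_split /=; apply: eq_bigr => p _.
    have E : cterm v w k p = cterm v (fadd (head_field K w) (tail_field K w)) k p.
      by rewrite -head_tail_field.
    by rewrite /tau E cterm_fadd_r vmulID; exact: vdotDr.
  by rewrite tau_head_sum0 // add0r.
rewrite /C -mulrA; apply: tau_sum_le => //; rewrite ?bx_uniq ?sqrtr_ge0 //.
- exact: bnd_quad.
- exact: bnd_tail.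
- exact: bnd_quad.
Qed.

End TrilinearForm.

(** * Perturbation of the right-hand side *)

Section Perturbation.
Context {R : realType}.
Implicit Types (a b u v w W g : field R) (k : idx).

Definition D3 (K : nat) u v : R := \sum_(k <- bx K) ksq R k * vdot (u k) (v k).
Definition G3 (K : nat) u v : R := \sum_(k <- bx K) vdot (u k) (v k).

Lemma G3_le K u g : inH u -> inH g -> G3 K u g <= nH u * nH g.
Proof.
move=> hu hg.
apply: (@le_trans _ _ (\sum_(k <- bx K) vn (u k) * vn (g k))).
  by apply: ler_sum => k _; exact: le_trans (ler_norm _) (normr_vdot_le _ _).
apply: sum_CauchySchwarz; [exact: nH_ge0|exact: nH_ge0| |].
  under eq_bigr do rewrite sqr_vn -[vnorm2 _]mul1r.
  by apply: inH_bnd => //; exact: bx_uniq.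
under eq_bigr do rewrite sqr_vn -[vnorm2 _]mul1r.
by apply: inH_bnd => //; exact: bx_uniq.
Qed.

Lemma normr_D3_le K u v : inV u -> inV v -> `|D3 K u v| <= nV u * nV v.
Proof.
move=> hu hv; apply: le_trans (ler_norm_sum _ _ _) _.
apply: (@le_trans _ _ (\sum_(k <- bx K) (kn k * vn (u k)) * (kn k * vn (v k)))).
  apply: ler_sum => k _; rewrite normrM ger0_norm ?ksq_ge0 //.
  rewrite mulrACA -expr2 sqr_kn ler_wpM2l ?ksq_ge0 //; exact: normr_vdot_le.
apply: sum_CauchySchwarz; [exact: nV_ge0|exact: nV_ge0| |].
  under eq_bigr do rewrite exprMn sqr_kn sqr_vn.
  by apply: inV_bnd => //; exact: bx_uniq.
under eq_bigr do rewrite exprMn sqr_kn sqr_vn.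
by apply: inV_bnd => //; exact: bx_uniq.
Qed.

Lemma D3_fadd_l K u u' v : D3 K (fadd u u') v = D3 K u v + D3 K u' v.
Proof.
rewrite /D3 -big_split; apply: eq_bigr => k _ /=.
by rewrite /fadd vdotDl mulrDr.
Qed.

Lemma D3_fadd_r K u v v' : D3 K u (fadd v v') = D3 K u v + D3 K u v'.
Proof.
rewrite /D3 -big_split; apply: eq_bigr => k _ /=.
by rewrite /fadd vdotDr mulrDr.
Qed.

Lemma fadd_fsubK a b : fadd a (fsub b a) = b.
Proof.
apply/funext => k; rewrite /fadd /fsub /vsub.
case: (a k) (b k) => [[x1 x2] [x3 x4]] [[y1 y2] [y3 y4]].
by congr ((_, _), (_, _)); rewrite /=; ring.
Qed.

Lemma nV_le_perturb a a' d : inV a -> inV a' -> nV (fsub a' a) <= d ->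
  nV a' <= nV a + d.
Proof.
move=> ha ha' h; rewrite -{1}(fadd_fsubK a a').
apply: le_trans (nV_fadd ha (inV_fsub ha' ha)) _.
exact: lerD.
Qed.

(** Changing one argument at a time gives three differences, each at most 40 d r^2 by
    [normr_B3_leV]. The factor 2 appears because W stands for w(s) + w(t), which is close to 2
    w(t). *)
Lemma B3_perturb K a b w a' b' W (r d : R) :
  inV a -> inV b -> inV w -> inV a' -> inV b' -> inV W ->
  nV a <= r -> nV b <= r -> nV b' <= r -> nV W <= r ->
  nV (fsub a' a) <= d -> nV (fsub b' b) <= d -> nV (fsub W (fadd w w)) <= d ->
  `|B3 K a' b' W - 2 * B3 K a b w| <= 120 * (d * r ^+ 2).
Proof.
move=> ha hb hw ha' hb' hW ra rb rb' rW da db dW.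
set ea := fsub a' a; set eb := fsub b' b; set eW := fsub W (fadd w w).
have hea : inV ea by exact: inV_fsub.
have heb : inV eb by exact: inV_fsub.
have hww : inV (fadd w w) by exact: inV_fadd.
have heW : inV eW by exact: inV_fsub.
have -> : B3 K a' b' W - 2 * B3 K a b w =
    B3 K ea b' W + B3 K a eb W + B3 K a b eW.
  rewrite -{1}(fadd_fsubK a a') B3_fadd_l // -/ea.
  rewrite -{1}(fadd_fsubK b b') B3_fadd_r // -/eb.
  rewrite -{1}(fadd_fsubK (fadd w w) W) !B3_fadd_W -/eW; ring.
have est (x y z : field R) (X Y Z : R) : inV x -> inV y -> inV z -> nV x <= X -> nV y <= Y ->
    nV z <= Z -> `|B3 K x y z| <= 40 * (X * Z * Y).
  move=> hx hy hz xX yY zZ; apply: le_trans (normr_B3_leV K hx hy hz) _.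
  rewrite ler_wpM2l //; apply: ler_pM => //; rewrite ?mulr_ge0 ?nV_ge0 //.
  by apply: ler_pM => //; exact: nV_ge0.
have h1 := est _ _ _ _ _ _ hea hb' hW da rb' rW.
have h2 := est _ _ _ _ _ _ ha heb hW ra db rW.
have h3 := est _ _ _ _ _ _ ha hb heW ra rb dW.
apply: le_trans (ler_normD _ _) _.
apply: le_trans (lerD (ler_normD _ _) (lexx _)) _.
apply: le_trans (lerD (lerD h1 h2) h3) _; lra.
Qed.

Lemma D3_perturb K w b' W (r d : R) :
  inV w -> inV b' -> inV W -> nV w <= r -> nV b' <= r ->
  nV (fsub b' w) <= d -> nV (fsub W (fadd w w)) <= d ->
  `|D3 K W b' - 2 * D3 K w w| <= 3 * (d * r).
Proof.
move=> hw hb' hW rw rb' db dW.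
set eb := fsub b' w; set eW := fsub W (fadd w w).
have heb : inV eb by exact: inV_fsub.
have heW : inV eW by apply: inV_fsub => //; exact: inV_fadd.
have -> : D3 K W b' - 2 * D3 K w w = 2 * D3 K w eb + D3 K eW b'.
  rewrite -{1}(fadd_fsubK (fadd w w) W) !D3_fadd_l -/eW.
  rewrite -{1 2}(fadd_fsubK w b') !D3_fadd_r -/eb; ring.
have h1 : `|D3 K w eb| <= r * d.
  apply: le_trans (normr_D3_le K hw heb) _.
  by apply: ler_pM => //; exact: nV_ge0.
have h2 : `|D3 K eW b'| <= d * r.
  apply: le_trans (normr_D3_le K heW hb') _.
  by apply: ler_pM => //; exact: nV_ge0.
apply: le_trans (ler_normD _ _) _; rewrite normrM ger0_norm //; lra.
Qed.

Definition rhs (nu : R) g u k : vec R :=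
  vsub (g k) (vadd (vscale nu (stokesA u k)) (bilB u u k)).

(** The nonlinear difference is split as B(u1,w) + B(w,u2): tested with w, the first term vanishes
    in the limit and the second involves only ||u2||, which is why the weight is built on u2
    alone. *)
Lemma rhs_diff K nu g1 g2 u1 u2 W : inV u1 -> inV u2 -> inV W ->
  \sum_(k <- bx K) vdot (W k) (vsub (rhs nu g1 u1 k) (rhs nu g2 u2 k)) =
  G3 K W (fsub g1 g2) - nu * D3 K W (fsub u1 u2) -
    (B3 K u1 (fsub u1 u2) W + B3 K (fsub u1 u2) u2 W).
Proof.
move=> h1 h2 hW; set w := fsub u1 u2.
have hw : inV w by exact: inV_fsub.
have E : B3 K u1 w W + B3 K w u2 W = B3 K u1 u1 W - B3 K u2 u2 W.
  have e1 : B3 K u1 u1 W = B3 K u1 u2 W + B3 K u1 w W.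
    by rewrite -B3_fadd_r // fadd_fsubK.
  have e2 : B3 K u1 u2 W = B3 K u2 u2 W + B3 K w u2 W.
    by rewrite -B3_fadd_l // fadd_fsubK.
  by rewrite e1 e2; ring.
rewrite E /G3 /D3 /B3 mulr_sumr -!sumrB; apply: eq_bigr => k _.
rewrite /w /fsub /rhs /stokesA !(vdotBr, vdotDr, vdotZr); ring.
Qed.

(** Here [u1], [u2] are values at the base time, [u1r], [u2r] at the integration time, and [ws] is
    the difference at the final time. Differences move by at most 2 d, so freezing costs 240 r^2 d
    for each of the two trilinear terms, 6 nu r d for the dissipation and 2 eps d for the force,
    uniformly in K. The forces stay at the integration time, being only measurable. *)
Lemma rhs_diff_le K (nu eps d r : R) g1 g2 u1 u2 u1r u2r ws w :
  0 < nu -> inH g1 -> inH g2 -> nH (fsub g1 g2) <= eps ->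
  inV u1 -> inV u2 -> inV u1r -> inV u2r -> inV ws ->
  0 <= d <= 1 -> nV (fsub u1r u1) <= d -> nV (fsub u2r u2) <= d ->
  nV (fsub ws (fsub u1 u2)) <= 2 * d ->
  r = 2 * (nV u1 + nV u2 + 1) -> w = fsub u1 u2 ->
  \sum_(k <- bx K) vdot (fadd ws w k) (vsub (rhs nu g1 u1r k) (rhs nu g2 u2r k))
  <= - (2 * nu) * D3 K w w + 2 * `|B3 K u1 w w| + 2 * `|B3 K w u2 w| +
     2 * eps * nH w + (2 * eps + 6 * nu * r + 480 * r ^+ 2) * d.
Proof.
move=> nu0 hg1 hg2 hg h1 h2 h1r h2r hws /andP[d0 d1] e1 e2 ew rE wE.
set W := fadd ws w; set wr := fsub u1r u2r.
have hw : inV w by rewrite wE; exact: inV_fsub.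
have hwr : inV wr by exact: inV_fsub.
have hW : inV W by exact: inV_fadd.
rewrite rhs_diff // -/wr.
have n1 := nV_ge0 u1; have n2 := nV_ge0 u2.
have eps0 : 0 <= eps by exact: le_trans (nH_ge0 _) hg.
have EW : fsub W (fadd w w) = fsub ws w.
  apply/funext => k; rewrite /W /fsub /fadd /vsub.
  case: (ws k) (w k) => [[x1 x2] [x3 x4]] [[y1 y2] [y3 y4]].
  by congr ((_, _), (_, _)); rewrite /=; ring.
have Ewr : fsub wr w = fsub (fsub u1r u1) (fsub u2r u2).
  apply/funext => k; rewrite wE /wr /fsub /vsub.
  case: (u1 k) (u2 k) => [[x1 x2] [x3 x4]] [[y1 y2] [y3 y4]].
  case: (u1r k) (u2r k) => [[z1 z2] [z3 z4]] [[t1 t2] [t3 t4]].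
  by congr ((_, _), (_, _)); rewrite /=; ring.
have dW : nV (fsub W (fadd w w)) <= 2 * d by rewrite EW wE.
have dw : nV (fsub wr w) <= 2 * d.
  rewrite Ewr; apply: le_trans (nV_fsub _ _) _; try exact: inV_fsub.
  lra.
have bw : nV w <= nV u1 + nV u2 by rewrite wE; exact: nV_fsub.
have bwr : nV wr <= r by have := nV_le_perturb hw hwr dw; lra.
have bww : nV (fadd w w) <= 2 * nV w.
  by apply: le_trans (nV_fadd hw hw) _; lra.
have bW : nV W <= r.
  by have := nV_le_perturb (inV_fadd hw hw) hW dW; lra.
have bu1 : nV u1 <= r by lra.
have bu2r : nV u2r <= r by have := nV_le_perturb h2 h2r e2; lra.
have bwr' : nV w <= r by lra.
have bu2 : nV u2 <= r by lra.
have e1' : nV (fsub u1r u1) <= 2 * d by lra.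
have e2' : nV (fsub u2r u2) <= 2 * d by lra.
have p1 := B3_perturb K h1 hw hw h1r hwr hW bu1 bwr' bwr bW e1' dw dW.
have p2 := B3_perturb K hw h2 hw hwr h2r hW bwr' bu2 bu2r bW dw e2' dW.
have p3 := D3_perturb K hw hwr hW bwr' bwr dw dW.
have hHw : inH w by case: hw.
have pG : G3 K W (fsub g1 g2) <= (2 * nH w + 2 * d) * eps.
  apply: le_trans (G3_le K _ (inH_fsub hg1 hg2)) _; first by case: hW.
  apply: ler_pM => //; try exact: nH_ge0.
  have E : W = fadd (fadd w w) (fsub ws w) by rewrite -EW fadd_fsubK.
  rewrite E; apply: le_trans (nH_fadd _ _) _.
  - exact: inH_fadd.
  - by apply: inH_fsub => //; case: hws.
  have := nH_fadd hHw hHw; have := nH_le_nV (inV_fsub hws hw).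
  by rewrite -wE in ew; lra.
have {p1} := lerNnormlW p1; have {p2} := lerNnormlW p2.
have {p3} := lerNnormlW p3.
have := lerNnormlW (lexx `|B3 K u1 w w|).
have := lerNnormlW (lexx `|B3 K w u2 w|).
move: pG `|B3 K u1 w w| `|B3 K w u2 w|.
move: (B3 K u1 w w) (B3 K w u2 w) (B3 K u1r wr W) (B3 K wr u2r W).
move: (D3 K w w) (D3 K W wr) (G3 K W _) (nH w).
move=> Dw DW G Hw b1 b2 b3 b4 hG a1 a2 h5 h4 h3 h6 h7.
have : - (nu * DW) <= - (2 * nu) * Dw + nu * (3 * (2 * d * r)) by nra.
lra.
Qed.

End Perturbation.

(** * Energy increments along solutions *)

Section Evolution.
Context {R : realType}.
Local Notation mu := (@lebesgue_measure R).
Local Notation coord := (@Defs.coord R).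
Implicit Types (u f : R -> field R).

Lemma sum_Rintegral_le (I : Type) (s : seq I) (c : I -> R) (F : I -> R -> R)
    (t1 t2 L : R) : t1 <= t2 ->
  (forall i, mu.-integrable `]t1, t2]%classic (EFin \o F i)) ->
  (forall r, t1 < r <= t2 -> \sum_(i <- s) c i * F i r <= L) ->
  \sum_(i <- s) c i * Rintegral mu `]t1, t2]%classic (F i) <= L * (t2 - t1).
Proof.
move=> t12 intF hL; set D := `]t1, t2]%classic.
have mD : measurable (D : set (measurableTypeR R)) by exact: measurable_itv.
have [intS ES] : mu.-integrable D (EFin \o (fun r => \sum_(i <- s) c i * F i r)) /\
    Rintegral mu D (fun r => \sum_(i <- s) c i * F i r) =
    \sum_(i <- s) c i * Rintegral mu D (F i).
  elim: s {hL} => [|i s [IH1 IH2]].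
    have -> : (fun r => \sum_(i <- [::]) c i * F i r) = cst 0.
      by apply/funext => r; rewrite big_nil.
    split; last by rewrite big_nil Rintegral_cst // mul0r.
    exact: integrable0.
  have -> : (fun r => \sum_(j <- i :: s) c j * F j r) =
      (fun r => c i * F i r + \sum_(j <- s) c j * F j r).
    by apply/funext => r; rewrite big_cons.
  have i1 : mu.-integrable D (EFin \o (fun r => c i * F i r)).
    rewrite (_ : EFin \o _ = fun r => ((c i)%:E * (EFin \o F i) r)%E).
      exact: integrableZl.
    by apply/funext => r /=; rewrite EFinM.
  split.
    pose G1 r : R := c i * F i r; pose G2 r : R := \sum_(j <- s) c j * F j r.
    rewrite (_ : EFin \o _ = ((EFin \o G1) \+ (EFin \o G2))%E).
      exact: integrableD.
    by apply/funext => r /=; rewrite EFinD.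
  by rewrite big_cons -IH2 -(RintegralZl _ mD (intF i)) -RintegralD.
have muD : mu D = (t2 - t1)%:E.
  by rewrite /D lebesgue_measure_itv /= lte_fin; case: ltgtP t12 => // -> _; rewrite subrr.
rewrite -ES; have -> : L * (t2 - t1) = Rintegral mu D (cst L).
  by rewrite Rintegral_cst // [X in fine X]muD.
apply: le_Rintegral => //.
  apply/integrableP; split; first exact: measurable_cst.
  rewrite (_ : (fun x => _) = cst `|L|%:E); last by apply/funext.
  by rewrite integral_cst // [X in (_ * X)%E]muD -EFinM ltry.
Qed.

(* [strong_sol] without its D(A) clause: the energy method only needs continuity
   in V. *)
Definition weak_sol (nu : R) f u : Prop :=
  [/\ (forall t, 0 <= t -> inV (u t)),
      (forall t, 0 <= t -> forall e, 0 < e -> exists2 d, 0 < d &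
          forall s, 0 <= s -> `|s - t| < d -> nV (fsub (u s) (u t)) < e) &
      (forall (k : idx) (i : 'I_4) (t : R), 0 <= t ->
          let F := fun s : R => coord (rhs nu (f s) (u s) k) i in
          mu.-integrable `[0, t]%classic (EFin \o F) /\
          coord (u t k) i = coord (u 0 k) i + Rintegral mu `[0, t]%classic F)].

Lemma normVE (v : field R) : normV v = 2 * pi * nV v.
Proof.
have pi0 : 0 <= 2 * pi :> R by rewrite mulr_ge0 // pi_ge0.
rewrite /normV /nV -/(S1 v) -[2 * pi]ger0_norm // -sqrtr_sqr -sqrtrM ?sqr_ge0 //.
by congr (Num.sqrt (_ * _)); ring.
Qed.

Lemma normHE (v : field R) : normH v = 2 * pi * nH v.
Proof.
have pi0 : 0 <= 2 * pi :> R by rewrite mulr_ge0 // pi_ge0.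
rewrite /normH /nH -/(S0 v) -[2 * pi]ger0_norm // -sqrtr_sqr -sqrtrM ?sqr_ge0 //.
by congr (Num.sqrt (_ * _)); ring.
Qed.

Lemma strong_weak_sol nu f u : strong_sol nu f u -> weak_sol nu f u.
Proof.
case=> h1 h2 _ h4; split=> // t t0 e e0.
have p0 : 0 < 2 * pi :> R by rewrite mulr_gt0 // pi_gt0.
have [d d0 h] := h2 t t0 (2 * pi * e) (mulr_gt0 p0 e0).
exists d => // s s0 st; have := h s s0 st.
by rewrite normVE ltr_pM2l.
Qed.

Lemma sol_incr nu f u k (i : 'I_4) t s : weak_sol nu f u -> 0 <= t <= s ->
  let F := fun s : R => coord (rhs nu (f s) (u s) k) i in
  mu.-integrable `]t, s]%classic (EFin \o F) /\
  coord (u s k) i - coord (u t k) i = Rintegral mu `]t, s]%classic F.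
Proof.
move=> [_ _ h] /andP[t0 ts] F.
have [i1 e1] := h k i t t0; have [i2 e2] := h k i s (le_trans t0 ts).
split.
  apply: integrableS i2 => //; apply: subset_itvr.
  by rewrite bnd_simp.
rewrite e1 e2 -(Rintegral_itvB i2) ?bnd_simp //.
rewrite -/F; ring.
Qed.

Lemma vdotE (w z : vec R) : vdot w z = \sum_(i < 4) coord w i * coord z i.
Proof.
by rewrite !big_ord_recr big_ord0 /= add0r /vdot /coord.
Qed.

Lemma coord_vsub (w z : vec R) i : coord (vsub w z) i = coord w i - coord z i.
Proof.
by case: i => -[|[|[|[|i]]]] hi //; rewrite /coord /vsub /= mulN1r.
Qed.

Lemma energy_incr_le nu f1 f2 u1 u2 K t s L :
  weak_sol nu f1 u1 -> weak_sol nu f2 u2 -> 0 <= t <= s ->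
  let w := fun r => fsub (u1 r) (u2 r) in
  (forall r, t < r <= s -> \sum_(k <- bx K)
     vdot (fadd (w s) (w t) k) (vsub (rhs nu (f1 r) (u1 r) k) (rhs nu (f2 r) (u2 r) k))
     <= L) ->
  \sum_(k <- bx K) vnorm2 (w s k) - \sum_(k <- bx K) vnorm2 (w t k) <= L * (s - t).
Proof.
move=> s1 s2 ts w hL.
pose I := [seq (k, i) | k <- bx K, i <- enum 'I_4].
pose F (ki : idx * 'I_4) r :=
  coord (rhs nu (f1 r) (u1 r) ki.1) ki.2 - coord (rhs nu (f2 r) (u2 r) ki.1) ki.2.
pose c (ki : idx * 'I_4) := coord (fadd (w s) (w t) ki.1) ki.2.
have sumI (G : idx -> 'I_4 -> R) :
    \sum_(ki <- I) G ki.1 ki.2 = \sum_(k <- bx K) \sum_(i < 4) G k i.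
  by rewrite /I big_allpairs; apply: eq_bigr => k _; rewrite big_enum.
have mD : measurable (`]t, s]%classic : set (measurableTypeR R)) by exact: measurable_itv.
have intF ki : mu.-integrable `]t, s]%classic (EFin \o F ki).
  have := integrableB mD (sol_incr ki.1 ki.2 s1 ts).1 (sol_incr ki.1 ki.2 s2 ts).1.
  by congr (integrable _ _ _); apply/funext => r /=; rewrite EFinB.
have EF ki : Rintegral mu `]t, s]%classic (F ki) =
    coord (w s ki.1) ki.2 - coord (w t ki.1) ki.2.
  rewrite /F RintegralB //; [|exact: (sol_incr ki.1 ki.2 s1 ts).1|
    exact: (sol_incr ki.1 ki.2 s2 ts).1].
  rewrite -(sol_incr ki.1 ki.2 s1 ts).2 -(sol_incr ki.1 ki.2 s2 ts).2.
  by rewrite /w !coord_vsub; ring.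
have t_le_s : t <= s by case/andP: ts.
have := @sum_Rintegral_le _ I c F t s L t_le_s intF.
have -> : \sum_(ki <- I) c ki * Rintegral mu `]t, s]%classic (F ki) =
    \sum_(k <- bx K) vnorm2 (w s k) - \sum_(k <- bx K) vnorm2 (w t k).
  rewrite -sumrB.
  transitivity (\sum_(ki <- I) coord (fadd (w s) (w t) ki.1) ki.2 *
      coord (vsub (w s ki.1) (w t ki.1)) ki.2).
    by apply: eq_bigr => ki _; rewrite EF coord_vsub.
  rewrite (sumI (fun k i => coord (fadd (w s) (w t) k) i *
    coord (vsub (w s k) (w t k)) i)).
  apply: eq_bigr => k _; rewrite -vdotE /fadd.
  move: (w s k) (w t k) => [[x1 x2] [x3 x4]] [[y1 y2] [y3 y4]].
  by rewrite /vdot /vadd /vsub /vnorm2 /cnorm2 /vadd /vscale /Defs.cscale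
    /Defs.cadd /=; ring.
apply=> r hr; apply: le_trans (hL r hr); rewrite le_eqVlt; apply/orP; left.
apply/eqP; transitivity (\sum_(ki <- I) coord (fadd (w s) (w t) ki.1) ki.2 *
   coord (vsub (rhs nu (f1 r) (u1 r) ki.1) (rhs nu (f2 r) (u2 r) ki.1)) ki.2).
  by apply: eq_bigr => ki _; rewrite coord_vsub.
rewrite (sumI (fun k i => coord (fadd (w s) (w t) k) i *
   coord (vsub (rhs nu (f1 r) (u1 r) k) (rhs nu (f2 r) (u2 r) k)) i)).
by apply: eq_bigr => k _; rewrite -vdotE.
Qed.

(** The time step d comes from continuity in V alone, and the thresholds [K1], [K2] involve only
    values at time t. For fixed s the estimate thus holds on all large boxes with the same
    right-hand side, and the box can be exhausted afterwards. *)
Lemma energy_dini (nu eps T0 M : R) f1 f2 u1 u2 :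
  0 < nu -> 0 <= T0 -> 1 <= M ->
  weak_sol nu f1 u1 -> weak_sol nu f2 u2 ->
  (forall t, 0 <= t -> inH (f1 t)) -> (forall t, 0 <= t -> inH (f2 t)) ->
  (forall t, T0 <= t -> nH (fsub (f1 t) (f2 t)) <= eps) ->
  forall t, T0 <= t -> forall eta, 0 < eta -> exists2 d, 0 < d &
  forall s, t < s < t + d ->
    S0 (fsub (u1 s) (u2 s)) <= S0 (fsub (u1 t) (u2 t)) +
    (- (2 * nu) * S1 (fsub (u1 t) (u2 t)) +
     20 * ((M * S0 (fsub (u1 t) (u2 t)) + S1 (fsub (u1 t) (u2 t)) / M) *
           nV (u2 t)) +
     2 * eps * nH (fsub (u1 t) (u2 t)) + eta) * (s - t).
Proof.
move=> nu0 T00 M1 s1 s2 hf1 hf2 hg t Tt eta eta0.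
have t0 : 0 <= t by exact: le_trans Tt.
have eps0 : 0 <= eps by exact: le_trans (nH_ge0 _) (hg t Tt).
have [V1 c1 _] := s1; have [V2 c2 _] := s2.
pose w r := fsub (u1 r) (u2 r); rewrite -/(w t).
have hw r : 0 <= r -> inV (w r) by move=> r0; apply: inV_fsub; auto.
set r0 := 2 * (nV (u1 t) + nV (u2 t) + 1).
set Q := 2 * eps + 6 * nu * r0 + 480 * r0 ^+ 2.
have r00 : 0 <= r0.
  by rewrite /r0; have := nV_ge0 (u1 t); have := nV_ge0 (u2 t); lra.
have Q0 : 0 <= Q.
  by rewrite /Q; have := mulr_ge0 (ltW nu0) r00; have := sqr_ge0 r0; lra.
(* The tolerance eta is shared out: eta / 4 for the freezing error Q e, eta / 2 for twice the skew
   term, eta / 4 for the truncated dissipation. *)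
pose e := Num.min 1 (eta / 4 / (Q + 1)).
have Q1 : 0 < Q + 1 by lra.
have e0 : 0 < e by rewrite lt_min ltr01 !divr_gt0.
have e1 : e <= 1 by rewrite /e ge_min lexx.
have eQ : Q * e <= eta / 4.
  have : e <= eta / 4 / (Q + 1) by rewrite /e ge_min lexx orbT.
  rewrite ler_pdivlMr //; lra.
have [d1 d10 hd1] := c1 t t0 e e0; have [d2 d20 hd2] := c2 t t0 e e0.
have hwt := hw t t0.
have [K1 hK1] := B3_skew (V1 t t0) hwt (divr_gt0 eta0 (ltr0n R 4)).
have eta1 : 0 < eta / (8 * nu) by rewrite divr_gt0 // mulr_gt0.
have [K2 hK2] := sum_bx_near (fun k => kvnorm2_ge0 k (w t k)) (proj2 hwt) eta1.
exists (Num.min d1 d2); first by rewrite lt_min d10 d20.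
move=> s /andP[ts std].
have s0 : 0 <= s by lra.
set L := (X in X * (s - t)).
have near r : t <= r <= s -> nV (fsub (u1 r) (u1 t)) <= e /\
    nV (fsub (u2 r) (u2 t)) <= e.
  move=> /andP[tr rs].
  have : `|r - t| < Num.min d1 d2 by rewrite ger0_norm; lra.
  rewrite lt_min => /andP[l1 l2].
  by split; apply: ltW; [apply: hd1|apply: hd2] => //; lra.
have step K : (maxn K1 K2 <= K)%N ->
    \sum_(k <- bx K) vnorm2 (w s k) <= S0 (w t) + L * (s - t).
  rewrite geq_max => /andP[k1 k2].
  have hb : \sum_(k <- bx K) vnorm2 (w t k) <= S0 (w t).
    by apply: sumZ2_ub; [move=> k; exact: vnorm2_ge0|case: hwt => -[]|exact: bx_uniq].
  suff : \sum_(k <- bx K) vnorm2 (w s k) - \sum_(k <- bx K) vnorm2 (w t k) <=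
      L * (s - t) by lra.
  apply: (energy_incr_le s1 s2); first by rewrite t0 ltW.
  move=> r /andP[tr rs].
  have [n1 n2] := near r ltac:(lra).
  have [m1 m2] := near s ltac:(lra).
  have rr0 : 0 <= r by lra.
  have ews : nV (fsub (w s) (w t)) <= 2 * e.
    have -> : fsub (w s) (w t) = fsub (fsub (u1 s) (u1 t)) (fsub (u2 s) (u2 t)).
      apply/funext => k; rewrite /w /fsub /vsub.
      case: (u1 s k) (u2 s k) => [[x1 x2] [x3 x4]] [[y1 y2] [y3 y4]].
      case: (u1 t k) (u2 t k) => [[z1 z2] [z3 z4]] [[t1 t2] [t3 t4]].
      by congr ((_, _), (_, _)); rewrite /=; ring.
    apply: le_trans (nV_fsub _ _) _; [apply: inV_fsub; auto|apply: inV_fsub; auto|lra].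
  have e01 : 0 <= e <= 1 by rewrite e1 ltW.
  have Tr : T0 <= r by lra.
  have := rhs_diff_le K nu0 (hf1 r rr0) (hf2 r rr0) (hg r Tr) (V1 t t0) (V2 t t0)
    (V1 r rr0) (V2 r rr0) (hw s s0) e01 n1 n2 ews (erefl r0) (erefl (w t)).
  move/le_trans; apply; rewrite -/(w t) -/Q /L.
  have b1 := hK1 K k1.
  have b2 := normr_B3_leM K M1 hwt (V2 t t0).
  have b3 : S1 (w t) - eta / (8 * nu) < D3 K (w t) (w t).
    by apply: lt_le_trans (hK2 K k2) _; apply: ler_sum => k _; rewrite vdotvv.
  have b4 : - (2 * nu) * D3 K (w t) (w t) <= - (2 * nu) * S1 (w t) + eta / 4.
    have : nu * (S1 (w t) - eta / (8 * nu)) <= nu * D3 K (w t) (w t).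
      by rewrite ler_wpM2l // ltW.
    rewrite mulrBr; have -> : nu * (eta / (8 * nu)) = eta / 8.
      by field; rewrite gt_eqF.
    lra.
  move: b1 b2 b4; move: `|B3 K (u1 t) (w t) (w t)| `|B3 K (w t) (u2 t) (w t)|.
  move: (D3 K (w t) (w t)) (S1 (w t)) (S0 (w t)) (nH (w t)) (nV (u2 t)).
  move=> D s1' s0' h' v' b b' h1 h2 h3.
  have : 2 * b' <= 20 * ((M * s0' + s1' / M) * v') by lra.
  lra.
have all_s (S : seq idx) : uniq S ->
    \sum_(k <- S) vnorm2 (w s k) <= S0 (w t) + L * (s - t).
  move=> uS; have [n Sn] := seq_sub_bx S.
  apply: le_trans (step (maxn n (maxn K1 K2)) (leq_maxr _ _)).
  apply: ler_sum_seq_sub => // [k /Sn|k]; last exact: vnorm2_ge0.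
  by apply: bx_sub; exact: leq_maxl.
exact: (sumZ2_lub (fun k => vnorm2_ge0 _) all_s).2.
Qed.

End Evolution.

(** * Dini derivatives *)

Section Dini.
Context {R : realType}.

(** The upper right Dini derivative of phi at t is at most a. *)
Definition dini_le (phi : R -> R) (t a : R) : Prop :=
  forall eta, 0 < eta -> exists2 d, 0 < d &
    forall s, t < s < t + d -> phi s <= phi t + (a + eta) * (s - t).

Lemma dini_leW phi t a b : a <= b -> dini_le phi t a -> dini_le phi t b.
Proof.
move=> ab h eta eta0; have [d d0 hd] := h eta eta0; exists d => // s hs.
apply: le_trans (hd s hs) _; rewrite lerD2l ler_wpM2r ?lerD2r //.
by case/andP: hs => ts _; rewrite subr_ge0 ltW.
Qed.

(** Comparison with a barrier: psi' = - lam psi + c + 2 eta beats the rate of phi by a margin. At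
    the last time ts where phi <= psi, which is attained by continuity, a step to the right costs
    phi only eta more than its rate, so phi <= psi persists beyond ts. *)
Lemma dini_gronwall (phi : R -> R) (T0 lam c : R) : 0 < lam -> 0 <= c ->
  0 <= phi T0 -> (forall t, T0 < t -> {for t, continuous phi}) ->
  (forall t, T0 <= t -> dini_le phi t (- lam * phi t + c)) ->
  forall t, T0 <= t -> phi t <= phi T0 * expR (- lam * (t - T0)) + c / lam.
Proof.
move=> lam0 c0 phi0 cphi hphi t1 Tt1; apply/ler_addgt0Pr => e e0.
(* With this value the excess 2 eta / lam of the barrier is exactly e. *)
pose eta := e * lam / 2.
have eta0 : 0 < eta by rewrite /eta divr_gt0 // mulr_gt0.
pose E t := expR (- lam * (t - T0)).
pose psi t := phi T0 * E t + (c + 2 * eta) / lam.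
have psiE : phi T0 * E t1 + c / lam + e = psi t1.
  by rewrite /psi /eta; field; rewrite gt_eqF.
rewrite -/(E t1) psiE leNgt; apply/negP => bad.
have E0 t : 0 < E t by exact: expR_gt0.
have E1 t : T0 <= t -> E t <= 1.
  by move=> Tt; rewrite /E -[leRHS]expR0 ler_expR; nra.
have Estep t s : E t * (1 - lam * (s - t)) <= E s.
  have -> : E s = E t * expR (- lam * (s - t)).
    by rewrite /E -expRD; congr expR; ring.
  rewrite ler_wpM2l ?(ltW (E0 t)) //; apply: le_trans (expR_ge1Dx _).
  by rewrite mulNr.
pose A := [set t | T0 <= t <= t1 /\ phi t <= psi t]%classic.
have AT : A T0.
  split; first by rewrite lexx.
  rewrite /psi /E subrr mulr0 expR0 mulr1 lerDl.
  by apply: divr_ge0; lra.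
have ubA : ubound A t1 by move=> t [/andP[_ ?] _].
have supA : has_sup A by split; [exists T0|exists t1].
set ts := sup A.
have Tts : T0 <= ts by apply: sup_upper_bound AT.
have tst1 : ts <= t1 by apply: ge_sup => //; exists T0.
have Ats : phi ts <= psi ts.
  rewrite leNgt; apply/negP => lt.
  have Tlt : T0 < ts.
    rewrite lt_neqAle Tts andbT; apply/eqP => eq.
    by move: lt; rewrite -eq ltNge; case: AT => _ ->.
  pose g := phi ts - psi ts.
  have g0 : 0 < g by rewrite /g subr_gt0.
  have /cvgrPdist_lt /(_ (g / 2)) := cphi ts Tlt.
  case=> [|d /= d0 hd]; first by rewrite divr_gt0.
  (* A Lipschitz constant of [psi], made positive by the 1. *)
  pose B := lam * phi T0 + 1.
  have B0 : 0 < B by rewrite /B; have := mulr_ge0 (ltW lam0) phi0; lra.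
  pose d' := Num.min d (g / 2 / B).
  have d'0 : 0 < d' by rewrite lt_min d0 !divr_gt0.
  have [t At ltt] := sup_adherent d'0 supA.
  have tts : t <= ts by apply: sup_upper_bound At.
  have [/andP[Tt _] pt] := At.
  have dist : `|ts - t| < d.
    rewrite ger0_norm ?subr_ge0 //.
    have : d' <= d by rewrite /d' ge_min lexx.
    by move: ltt; rewrite -/ts; lra.
  have h1 : `|phi ts - phi t| < g / 2 by exact: hd.
  have h2 : psi t - psi ts <= g / 2.
    have -> : psi t - psi ts = phi T0 * (E t - E ts) by rewrite /psi; ring.
    have l1 : (ts - t) * B <= g / 2.
      have : d' <= g / 2 / B by rewrite /d' ge_min lexx orbT.
      by rewrite -ler_pdivlMr //; move: ltt; rewrite -/ts; lra.
    have l2 : E t - E ts <= lam * (ts - t).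
      have := Estep t ts; have := E1 t Tt; have := E0 t.
      have : 0 <= lam * (ts - t) by rewrite mulr_ge0 ?(ltW lam0) // subr_ge0.
      nra.
    apply: le_trans (ler_wpM2l phi0 l2) _; apply: le_trans l1.
    by rewrite /B; lra.
  have := ler_norm (phi ts - phi t); rewrite /g in h1 h2 *; lra.
have tlt : ts < t1.
  rewrite lt_neqAle tst1 andbT; apply/eqP => eq.
  by move: bad; rewrite -eq ltNge Ats.
have [d d0 hd] := hphi ts Tts eta eta0.
(* The bound h <= 1 / lam keeps 1 - h lam nonnegative, so that a gap psi - phi at ts is not reversed
   by the linear step. *)
pose h := Num.min (d / 2) (Num.min lam^-1 (t1 - ts)).
have h0 : 0 < h by rewrite !lt_min divr_gt0 //= invr_gt0 lam0 subr_gt0.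
have hd2 : h <= d / 2 by rewrite /h ge_min lexx.
have hl : h * lam <= 1.
  by rewrite -ler_pdivlMr // mul1r /h !ge_min lexx orbT.
have ht : h <= t1 - ts by rewrite /h !ge_min lexx !orbT.
have := hd (ts + h); rewrite ltrDl h0 ltrD2l /=.
have -> : h < d by lra.
move=> /(_ isT); rewrite (_ : ts + h - ts = h); last by ring.
move=> hphis.
have hpsis : psi ts + (- lam * psi ts + c + 2 * eta) * h <= psi (ts + h).
  have -> : psi ts + (- lam * psi ts + c + 2 * eta) * h =
      phi T0 * (E ts * (1 - lam * (ts + h - ts))) + (c + 2 * eta) / lam.
    by rewrite /psi; field; rewrite gt_eqF.
  by rewrite /psi lerD2r ler_wpM2l.
have Ah : A (ts + h).
  split; first by apply/andP; split; lra.
  apply: le_trans hphis (le_trans _ hpsis).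
  have : 0 <= (psi ts - phi ts) * (1 - h * lam).
    by rewrite mulr_ge0 // subr_ge0.
  have := mulr_gt0 eta0 h0; lra.
have := sup_upper_bound supA Ah; rewrite -/ts; lra.
Qed.

(** The product and chain rules for one-sided bounds; D >= 0 and y >= 0 preserve the direction of
    the inequalities. Instead of expanding exp(h be) to second order, both sides are multiplied by 1
    - h be, and exp(x) (1 - x) <= 1 is used. *)
Lemma dini_mul_expR (y z : R -> R) (D t a b : R) : 0 <= D ->
  (forall s, t <= s -> 0 <= y s) ->
  dini_le y t a -> dini_le z t b ->
  dini_le (fun s => y s * expR (D * z s)) t
    ((a + D * b * y t) * expR (D * z t)).
Proof.
move=> D0 y0 hy hz eta eta0; set E := expR (D * z t); set yt := y t.
have E0 : 0 < E by exact: expR_gt0.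
have yt0 : 0 <= yt by exact: y0.
have W0 : 0 < 2 * E * (1 + D * yt).
  by rewrite !mulr_gt0 //; have := mulr_ge0 D0 yt0; lra.
pose eta1 := eta / (2 * E * (1 + D * yt)).
have eta10 : 0 < eta1 by rewrite divr_gt0.
have eta1E : (eta1 + D * eta1 * yt) * E = eta / 2.
  by rewrite /eta1; field; rewrite !gt_eqF //; have := mulr_ge0 D0 yt0; lra.
have [d1 d10 hd1] := hy eta1 eta10; have [d2 d20 hd2] := hz eta1 eta10.
pose a' := a + eta1; pose be := D * (b + eta1).
pose Q := a' * E + be * yt * E + eta / 2.
have QE : Q = (a + D * b * yt) * E + eta.
  have -> : Q = (a + D * b * yt) * E + (eta1 + D * eta1 * yt) * E + eta / 2.
    by rewrite /Q /a' /be; ring.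
  by rewrite eta1E; lra.
(* A step h below [d3] ensures h be < 1; below [d4] it keeps the second-order remainder h be Q under
   eta / 2. *)
pose d3 := (2 * (`|be| + 1))^-1; pose d4 := eta / 2 / (`|be * Q| + 1).
have nb := normr_ge0 be; have nbQ := normr_ge0 (be * Q).
have d30 : 0 < d3 by rewrite invr_gt0; lra.
have d40 : 0 < d4 by rewrite !divr_gt0 //; lra.
exists (Num.min (Num.min d1 d2) (Num.min d3 d4)).
  by rewrite !lt_min d10 d20 d30 d40.
move=> s /andP[ts]; rewrite -ltrBlDl !lt_min => /andP[/andP[s1 s2] /andP[s3 s4]].
have h0 : 0 < s - t by rewrite subr_gt0.
have hy' : y s <= yt + a' * (s - t).
  by apply: hd1; rewrite ts /= -ltrBlDl.
have hz' : z s <= z t + (b + eta1) * (s - t).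
  by apply: hd2; rewrite ts /= -ltrBlDl.
rewrite -/E -/yt -QE; move: (s - t) h0 s3 s4 hy' hz' => h h0 s3 s4 hy' hz'.
have hb : h * be < 1.
  have : h * (2 * (`|be| + 1)) < 1 by rewrite -ltr_pdivlMr ?mul1r //; lra.
  have := ler_norm be; have := mulr_ge0 (ltW h0) nb; nra.
have hQ : h * (be * Q) <= eta / 2.
  have : h * (`|be * Q| + 1) <= eta / 2 by rewrite -ler_pdivlMr ?(ltW s4) //; lra.
  have := ler_norm (be * Q); nra.
have hE : expR (D * z s) * (1 - h * be) <= E.
  apply: (@le_trans _ _ (E * expR (h * be) * (1 - h * be))).
    rewrite ler_wpM2r ?subr_ge0 ?(ltW hb) // /E -expRD ler_expR /be.
    have := ler_wpM2l D0 hz'; lra.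
  rewrite -mulrA ler_piMr ?(ltW E0) //.
  have : 1 - h * be <= expR (- (h * be)) by have := expR_ge1Dx (- (h * be)).
  move=> l; apply: (@le_trans _ _ (expR (h * be) * expR (- (h * be)))).
    by rewrite ler_wpM2l // expR_ge0.
  by rewrite -expRD subrr expR0.
have pb : 0 < 1 - h * be by lra.
rewrite -(ler_pM2r pb) -mulrA.
have ys0 : 0 <= y s by exact/y0/ltW.
apply: (@le_trans _ _ (y s * E)); first by rewrite ler_wpM2l.
apply: (@le_trans _ _ ((yt + a' * h) * E)); first by rewrite ler_wpM2r // ltW.
have -> : (yt * E + Q * h) * (1 - h * be) =
  (yt + a' * h) * E + h * (eta / 2 - h * (be * Q)) by rewrite /Q; ring.
by rewrite lerDl mulr_ge0 ?subr_ge0 // ltW.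
Qed.

End Dini.

(** * Determining modes *)

Section DeterminingModes.
Context {R : realType}.
Local Notation mu := (@lebesgue_measure R).
Local Notation coord := (@Defs.coord R).
Implicit Types (u f : R -> field R).

(** The zero solution with zero force: compared with it, [energy_dini] becomes the energy inequality
    of a single solution. *)
Definition zfield : field R := fun=> vec0 R.

Lemma fsub_zfield (v : field R) : fsub v zfield = v.
Proof.
apply/funext => k; rewrite /fsub /vsub /zfield.
by case: (v k) => [[a b] [c d]]; congr ((_, _), (_, _)); rewrite /= mulr0 addr0.
Qed.

Lemma bnd_zfield om : bnd om zfield 0.
Proof.
move=> s _; rewrite expr0n big1 // => k _.
by rewrite /zfield vnorm20 mulr0.
Qed.

Lemma nV_zfield : nV zfield = 0.
Proof.
apply/eqP; rewrite eq_le nV_ge0 andbT.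
exact: (bnd_nV (lexx 0) (bnd_zfield _)).2.
Qed.

Lemma inV_zfield : inV zfield.
Proof.
split; last exact: (bnd_nV (lexx 0) (bnd_zfield _)).1.
split=> //; last exact: (bnd_nH (lexx 0) (bnd_zfield _)).1.
- by move=> k; congr ((_, _), (_, _)); rewrite /= oppr0.
- by move=> k; congr (_, _); rewrite /= !mulr0 addr0.
Qed.

Lemma bilB_zfield k : bilB zfield zfield k = vec0 R.
Proof.
rewrite /bilB; case: eqVneq => // _.
have -> : conv_part zfield zfield k = fun=> vec0 R.
  apply/funext => n; rewrite conv_partE big1 // => p _.
  by rewrite /cterm /cvmul /cmul /zfield /= !mulr0 subr0 addr0.
have lim0 : seqlim (fun=> 0 : R) = 0.
  by apply: cvg_lim; [exact: Rhausdorff|exact: cvg_cst].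
rewrite /vlim /= lim0.
by congr ((_, _), (_, _)); rewrite /= !(oppr0, mulr0, addr0).
Qed.

Lemma weak_sol_zfield nu : weak_sol nu (fun=> zfield) (fun=> zfield).
Proof.
split=> [t _|t _ e e0|k i t _ F].
- exact: inV_zfield.
- by exists 1 => // s _ _; rewrite fsub_zfield nV_zfield.
have coord0 (j : 'I_4) : coord (rhs nu zfield zfield k) j = 0.
  rewrite /rhs bilB_zfield /stokesA /zfield.
  by case: j => -[|[|[|[|j]]]] hj //;
    rewrite /Defs.coord /= !(mulr0, addr0, mulN1r, oppr0).
have -> : F = cst 0 by apply/funext => s; exact: coord0.
split; first exact: integrable0.
by rewrite Rintegral_cst // mul0r addr0.
Qed.

Lemma weak_sol_nH_fsub_continuous nu nu' f1 f2 u1 u2 t :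
  weak_sol nu f1 u1 -> weak_sol nu' f2 u2 -> 0 < t ->
  {for t, continuous (fun r => nH (fsub (u1 r) (u2 r)))}.
Proof.
move=> [V1 c1 _] [V2 c2 _] t0; apply/cvgrPdist_lt => e e0.
have e2 : 0 < e / 2 by rewrite divr_gt0.
have [d1 d10 h1] := c1 t (ltW t0) _ e2; have [d2 d20 h2] := c2 t (ltW t0) _ e2.
exists (Num.min t (Num.min d1 d2)); first by rewrite /= !lt_min t0 d10 d20.
move=> s /=; rewrite !lt_min => /andP[st /andP[st1 st2]].
have s0 : 0 <= s by have := ler_norm (t - s); lra.
rewrite distrC in st1 st2.
have l1 := h1 s s0 st1; have l2 := h2 s s0 st2.
have hws := inV_fsub (V1 s s0) (V2 s s0).
have hwt := inV_fsub (V1 t (ltW t0)) (V2 t (ltW t0)).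
have hd1 := inV_fsub (V1 s s0) (V1 t (ltW t0)).
have hd2 := inV_fsub (V2 s s0) (V2 t (ltW t0)).
have E : fsub (fsub (u1 s) (u2 s)) (fsub (u1 t) (u2 t)) =
    fsub (fsub (u1 s) (u1 t)) (fsub (u2 s) (u2 t)).
  apply/funext => k; rewrite /fsub /vsub.
  case: (u1 s k) (u2 s k) => [[x1 x2] [x3 x4]] [[y1 y2] [y3 y4]].
  case: (u1 t k) (u2 t k) => [[z1 z2] [z3 z4]] [[t1 t2] [t3 t4]].
  by congr ((_, _), (_, _)); rewrite /=; ring.
have near (a b : field R) : inV a -> inV b -> nV (fsub b a) < e -> nH b < nH a + e.
  move=> ha hb lt; rewrite -[b in nH b](fadd_fsubK a b).
  have hba := inV_fsub hb ha.
  apply: le_lt_trans (nH_fadd ha.1 hba.1) _; rewrite ltrD2l.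
  exact: le_lt_trans (nH_le_nV hba) lt.
have N1 : nV (fsub (fsub (u1 s) (u2 s)) (fsub (u1 t) (u2 t))) < e.
  by rewrite E; apply: le_lt_trans (nV_fsub hd1 hd2) _; lra.
have N2 : nV (fsub (fsub (u1 t) (u2 t)) (fsub (u1 s) (u2 s))) < e.
  apply: le_lt_trans N1; apply: (bnd_nV (nV_ge0 _) _).2.
  have := bndN (inV_bnd (inV_fsub hws hwt)).
  congr bnd; apply/funext => k; rewrite /fscale /fsub /vsub.
  case: (u1 s k) (u2 s k) => [[x1 x2] [x3 x4]] [[y1 y2] [y3 y4]].
  case: (u1 t k) (u2 t k) => [[z1 z2] [z3 z4]] [[t1 t2] [t3 t4]].
  by congr ((_, _), (_, _)); rewrite /=; ring.
have := near _ _ hwt hws N1; have := near _ _ hws hwt N2.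
by rewrite ltr_norml => a b; apply/andP; split; lra.
Qed.

Lemma weak_sol_S0_fsub_continuous nu nu' f1 f2 u1 u2 t :
  weak_sol nu f1 u1 -> weak_sol nu' f2 u2 -> 0 < t ->
  {for t, continuous (fun r => S0 (fsub (u1 r) (u2 r)))}.
Proof.
move=> s1 s2 t0; have h := weak_sol_nH_fsub_continuous s1 s2 t0.
have -> : (fun r => S0 (fsub (u1 r) (u2 r))) =
    (fun r => nH (fsub (u1 r) (u2 r)) * nH (fsub (u1 r) (u2 r))).
  by apply/funext => r; rewrite -expr2 sqr_nH.
exact: cvgM.
Qed.

Lemma weak_sol_S0_continuous nu f u t : weak_sol nu f u -> 0 < t ->
  {for t, continuous (fun r => S0 (u r))}.
Proof.
move=> hu t0; have -> : (fun r => S0 (u r)) = (fun r => S0 (fsub (u r) zfield)).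
  by apply/funext => r; rewrite fsub_zfield.
exact: weak_sol_S0_fsub_continuous hu (weak_sol_zfield nu) t0.
Qed.

(** Young's inequality bounds the work of the force by nu |u|^2 + F^2 / nu, and Poincare's
    inequality pays the first term with half of the dissipation 2 nu ||u||^2. *)
Lemma S0_dini nu F f u t : 0 < nu -> weak_sol nu f u ->
  (forall t, 0 <= t -> inH (f t)) -> (forall t, 0 <= t -> nH (f t) <= F) ->
  0 <= t -> dini_le (fun r => S0 (u r)) t (- nu * S1 (u t) + F ^+ 2 / nu).
Proof.
move=> nu0 hu hf hF t0.
have hF' r : 0 <= r -> nH (fsub (f r) zfield) <= F.
  by move=> r0; rewrite fsub_zfield; exact: hF.
have hut : inV (u t) by case: hu => V _ _; exact: V.
apply: (@dini_leW _ _ _ (- (2 * nu) * S1 (u t) + 2 * F * nH (u t))); last first.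
  move=> eta eta0.
  have [d d0 hd] := energy_dini nu0 (lexx 0) (lexx 1) hu (weak_sol_zfield nu) hf
    (fun _ _ => inV_zfield.1) hF' t0 eta0.
  exists d => // s hs; have := hd s hs.
  by rewrite !fsub_zfield nV_zfield mulr0 mulr0 addr0.
have := S0_le_S1 hut; rewrite -sqr_nH => le.
have amgm : 2 * F * nH (u t) <= nu * nH (u t) ^+ 2 + F ^+ 2 / nu.
  rewrite -subr_ge0.
  have -> : nu * nH (u t) ^+ 2 + F ^+ 2 / nu - 2 * F * nH (u t) =
    (nu * nH (u t) - F) ^+ 2 / nu by field; rewrite gt_eqF.
  by rewrite divr_ge0 ?sqr_ge0 // ltW.
have := ler_wpM2l (ltW nu0) le; lra.
Qed.

Lemma S0_bounded nu F f u : 0 < nu -> weak_sol nu f u ->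
  (forall t, 0 <= t -> inH (f t)) -> (forall t, 0 <= t -> nH (f t) <= F) ->
  forall t, 0 <= t -> S0 (u t) <= S0 (u 0) + F ^+ 2 / nu ^+ 2.
Proof.
move=> nu0 hu hf hF t t0.
have c0 : 0 <= F ^+ 2 / nu by rewrite divr_ge0 ?sqr_ge0 // ltW.
have := @dini_gronwall _ (fun r => S0 (u r)) 0 nu (F ^+ 2 / nu) nu0 c0 (S0_ge0 _).
move=> gw; apply: le_trans (gw _ _ t t0) _.
- by move=> s; exact: weak_sol_S0_continuous hu.
- move=> s s0; apply: dini_leW (S0_dini nu0 hu hf hF s0).
  have hus : inV (u s) by case: hu => V _ _; exact: V.
  have := ler_wpM2l (ltW nu0) (S0_le_S1 hus); lra.
have -> : F ^+ 2 / nu / nu = F ^+ 2 / nu ^+ 2 by field; rewrite gt_eqF.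
rewrite lerD2r ler_piMr ?S0_ge0 // -[leRHS]expR0 ler_expR subr0; nra.
Qed.

(** Modes removed by the projection satisfy N^2 < |k|^2, so N^2 times their energy is covered by
    ||w||^2. *)
Lemma S0_PN_le (N : R) (v1 v2 : field R) : inV v1 -> inV v2 ->
  N ^+ 2 * S0 (fsub v1 v2) <=
  N ^+ 2 * S0 (fsub (PN N v1) (PN N v2)) + S1 (fsub v1 v2).
Proof.
move=> h1 h2; set w := fsub v1 v2; set pw := fsub (PN N v1) (PN N v2).
have hw : inV w by exact: inV_fsub.
have pwE k : pw k = if ksq R k <= N ^+ 2 then w k else vec0 R.
  rewrite /pw /w /fsub /PN; case: ifP => // _.
  by congr ((_, _), (_, _)); rewrite /= mulr0 addr0.
have fin : (sumZ2 (fun k => vnorm2 (pw k)) < +oo)%E.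
  apply: (bnd_nH (nH_ge0 w) _).1 => s us.
  apply: le_trans (inH_bnd hw.1 us); apply: ler_sum => k _; rewrite pwE !mul1r.
  by case: ifP => // _; rewrite vnorm20 vnorm2_ge0.
have [->|N0] := eqVneq N 0; first by rewrite expr0n !mul0r add0r S1_ge0.
have N2 : 0 < N ^+ 2 by rewrite exprn_even_gt0.
rewrite -ler_pdivlMl //.
apply: (sumZ2_lub (fun k => vnorm2_ge0 (w k)) _).2 => s us.
apply: (@le_trans _ _ (\sum_(k <- s) vnorm2 (pw k) +
    (N ^+ 2)^-1 * \sum_(k <- s) ksq R k * vnorm2 (w k))).
  rewrite mulr_sumr -big_split /=; apply: ler_sum => k _; rewrite pwE.
  case: ifPn => [_|]; first by rewrite lerDl mulr_ge0 ?kvnorm2_ge0 ?invr_ge0 ?(ltW N2).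
  rewrite -ltNge vnorm20 add0r => lt.
  by rewrite mulrA ler_peMl ?vnorm2_ge0 // ler_pdivlMl // mulr1 ltW.
rewrite mulrDr mulKf ?gt_eqF //; apply: lerD.
  by apply: sumZ2_ub => // k; exact: vnorm2_ge0.
rewrite ler_wpM2l ?invr_ge0 ?(ltW N2) // -sqr_nV; exact: inV_bnd.
Qed.

Lemma tends0_normH (v : R -> field R) : tends0 (fun t => normH (v t)) <->
  forall e, 0 < e -> exists2 T, 0 <= T & forall t, T <= t -> nH (v t) <= e.
Proof.
have p0 : 0 < 2 * pi :> R by rewrite mulr_gt0 // pi_gt0.
have n0 (t : R) : 0 <= normH (v t) by exact: sqrtr_ge0.
split=> [/cvgrPdist_lt h e e0|h].
  have [T [_ hT]] := h _ (mulr_gt0 p0 e0).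
  exists (Num.max 0 T + 1); first by rewrite addr_ge0 // le_max lexx.
  move=> t Tt.
  have : T < t.
    by apply: lt_le_trans Tt; rewrite ltr_pwDr // le_max lexx orbT.
  move/hT; rewrite sub0r normrN ger0_norm // normHE ltr_pM2l //; exact: ltW.
apply/cvgrPdist_lt => e e0.
have e1 : 0 < e / (2 * pi) / 2 by rewrite !divr_gt0.
have [T T0 hT] := h _ e1; exists T; split; first exact: num_real.
move=> t Tt; rewrite sub0r normrN ger0_norm // normHE.
apply: le_lt_trans (ler_wpM2l (ltW p0) (hT t (ltW Tt))) _.
by rewrite mulrA mulrCA divff ?gt_eqF // mulr1 ltr_pdivrMr //; lra.
Qed.

(** M makes 20 v / M <= nu, so one half of the dissipation 2 nu S absorbs the gradient part of the
    trilinear term; the other half becomes nu N^2 y by the spectral gap. The remaining 20 v + 400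
    v^2 / nu is at most nu + 500 v^2 / nu, and the force costs another nu y, whence 2 nu. *)
Lemma energy_rate_le (nu eps N v S y p n M : R) : 0 < nu -> 0 <= v ->
  0 <= S -> y = n ^+ 2 -> p <= eps ^+ 2 -> N ^+ 2 * y <= N ^+ 2 * p + S ->
  M = 1 + 20 * v / nu ->
  - (2 * nu) * S + 20 * ((M * y + S / M) * v) + 2 * eps * n <=
  - (nu * N ^+ 2 - 2 * nu - 500 * v ^+ 2 / nu) * y +
    (nu * N ^+ 2 + nu^-1) * eps ^+ 2.
Proof.
move=> nu0 v0 hS yE pe hN ME.
have inu0 : 0 < nu^-1 by rewrite invr_gt0.
have M1 : 1 <= M by rewrite ME lerDl !mulr_ge0 // ltW.
have M0 : 0 < M by lra.
have y0 : 0 <= y by rewrite yE sqr_ge0.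
have h1 : 20 * (S / M * v) <= nu * S.
  have -> : 20 * (S / M * v) = S * (20 * v) / M by ring.
  rewrite ler_pdivrMr //.
  have -> : nu * S * M = nu * S + S * (20 * v) by rewrite ME; field; rewrite gt_eqF.
  by rewrite lerDr mulr_ge0 // ltW.
have h2 : 20 * (M * y * v) <= (nu + 500 * v ^+ 2 / nu) * y.
  have -> : 20 * (M * y * v) = (20 * v + 400 * v ^+ 2 / nu) * y.
    by rewrite ME; field; rewrite gt_eqF.
  rewrite ler_wpM2r // -subr_ge0.
  have -> : nu + 500 * v ^+ 2 / nu - (20 * v + 400 * v ^+ 2 / nu) =
     (nu - 10 * v) ^+ 2 / nu by field; rewrite gt_eqF.
  by rewrite divr_ge0 ?sqr_ge0 // ltW.
have h3 : 2 * eps * n <= nu * y + nu^-1 * eps ^+ 2.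
  rewrite yE -subr_ge0.
  have -> : nu * n ^+ 2 + nu^-1 * eps ^+ 2 - 2 * eps * n =
    (nu * n - eps) ^+ 2 / nu by field; rewrite gt_eqF.
  by rewrite divr_ge0 ?sqr_ge0 // ltW.
have h4 : nu * (N ^+ 2 * y) <= nu * N ^+ 2 * eps ^+ 2 + nu * S.
  apply: le_trans (ler_wpM2l (ltW nu0) hN) _.
  rewrite mulrDr lerD2r -mulrA ler_wpM2l ?(ltW nu0) //.
  by rewrite ler_wpM2l ?sqr_ge0.
lra.
Qed.

Lemma determining_modes (nu : R) : 0 < nu -> finite_determining_modes nu.
Proof.
move=> nu0 f1 f2 [hf1 _ _] [hf2 _ [Mf hMf]].
have p0 : 0 < 2 * pi :> R by rewrite mulr_gt0 // pi_gt0.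
pose F := Mf / (2 * pi).
have hF t : 0 <= t -> nH (f2 t) <= F.
  by move=> t0; rewrite /F ler_pdivlMr // mulrC -normHE; exact: hMf.
(* Chosen so that nu N^2 - 2 nu - D F^2 / nu = nu for the D below; it depends on f2 and nu only. *)
pose N := Num.sqrt (3 + 500 * F ^+ 2 / nu ^+ 4).
have Np : 0 < 3 + 500 * F ^+ 2 / nu ^+ 4.
  have F0 : 0 <= 500 * F ^+ 2 := mulr_ge0 (ler0n R 500) (sqr_ge0 F).
  by have := divr_ge0 F0 (ltW (exprn_gt0 4 nu0)); lra.
have NE : N ^+ 2 = 3 + 500 * F ^+ 2 / nu ^+ 4 by apply: sqr_sqrtr; exact: ltW Np.
exists N; first by rewrite sqrtr_gt0.
move=> u1 u2 /strong_weak_sol s1 /strong_weak_sol s2 /tends0_normH hP /tends0_normH hg.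
apply/tends0_normH => e e0.
have [V1 _ _] := s1; have [V2 _ _] := s2.
pose w t := fsub (u1 t) (u2 t).
pose y t := S0 (w t); pose z t := S0 (u2 t).
(* D nu = 500 / nu, so the dissipation in z' cancels the coefficient of ||u2||^2 in the rate of
   y. *)
pose D := 500 / nu ^+ 2.
have D0 : 0 <= D := divr_ge0 (ler0n R 500) (ltW (exprn_gt0 2 nu0)).
(* The initial datum enters here, hence in [EZ] and in the tolerance [eps], after N has been
   fixed. *)
pose Z := S0 (u2 0) + F ^+ 2 / nu ^+ 2.
have hZ t : 0 <= t -> z t <= Z by exact: (S0_bounded nu0 s2 hf2 hF).
pose EZ := expR (D * Z).
have EZ0 : 0 < EZ by exact: expR_gt0.
pose C := (nu * N ^+ 2 + nu^-1) * EZ / nu.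
have inu0 : 0 < nu^-1 by rewrite invr_gt0.
have h0 : 0 < nu * N ^+ 2 + nu^-1.
  by rewrite ltr_wpDl // mulr_ge0 ?sqr_ge0 // ltW.
have C0 : 0 < C by rewrite !mulr_gt0.
(* The limiting level c / nu of Y becomes e^2 / 2, half of the allowed energy e^2. *)
pose eps := Num.sqrt (e ^+ 2 / 2 / C).
have e20 : 0 < e ^+ 2 / 2 := divr_gt0 (exprn_gt0 2 e0) (ltr0n R 2).
have eC0 : 0 < e ^+ 2 / 2 / C := divr_gt0 e20 C0.
have eps0 : 0 < eps by rewrite sqrtr_gt0.
have epsE : C * eps ^+ 2 = e ^+ 2 / 2.
  rewrite sqr_sqrtr; first by field; rewrite gt_eqF.
  exact: ltW eC0.
have [T1 T10 hT1] := hP eps eps0; have [T2 T20 hT2] := hg eps eps0.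
pose T0 := Num.max T1 T2.
have T1T : T1 <= T0 by rewrite le_max lexx.
have T2T : T2 <= T0 by rewrite le_max lexx orbT.
have T00 : 0 <= T0 by exact: le_trans T1T.
pose Y t := y t * expR (D * z t).
have y0 t : 0 <= y t by exact: S0_ge0.
have Y0 t : 0 <= Y t by rewrite mulr_ge0 ?expR_ge0.
pose c := (nu * N ^+ 2 + nu^-1) * eps ^+ 2 * EZ.
have c0 : 0 <= c.
  by rewrite mulr_ge0 ?(ltW EZ0) // mulr_ge0 ?sqr_ge0 // ltW.
have cE : c / nu = e ^+ 2 / 2.
  by rewrite -epsE /c /C; ring.
have Yc t : T0 < t -> {for t, continuous Y}.
  move=> Tt; have t0 : 0 < t by exact: le_lt_trans Tt.
  apply: cvgM; first exact: (weak_sol_S0_fsub_continuous s1 s2 t0).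
  apply: (@continuous_comp _ _ _ (fun r => D * z r) expR); last exact: continuous_expR.
  apply: cvgM; first exact: cvg_cst.
  exact: (weak_sol_S0_continuous s2 t0).
have Yd t : T0 <= t -> dini_le Y t (- nu * Y t + c).
  move=> Tt; have t0 : 0 <= t by exact: le_trans Tt.
  have v0 := nV_ge0 (u2 t).
  pose M := 1 + 20 * nV (u2 t) / nu.
  have M1 : 1 <= M by rewrite /M lerDl !mulr_ge0 // ltW.
  have hg' r : T0 <= r -> nH (fsub (f1 r) (f2 r)) <= eps.
    by move=> Tr; apply: hT2; exact: le_trans Tr.
  have d1 := energy_dini nu0 T00 M1 s1 s2 hf1 hf2 hg' Tt.
  have hPN := S0_PN_le N (V1 t t0) (V2 t t0).
  have hp : S0 (fsub (PN N (u1 t)) (PN N (u2 t))) <= eps ^+ 2.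
    rewrite -sqr_nH; apply: lerXn2r; [exact: nH_ge0|exact: ltW|].
    by apply: hT1; exact: le_trans Tt.
  have rate := energy_rate_le nu0 v0 (S1_ge0 (w t)) (esym (sqr_nH (w t))) hp hPN
    (erefl M).
  have {d1} d1 : dini_le y t _ := dini_leW rate d1.
  have d2 := S0_dini nu0 s2 hf2 hF t0.
  have := dini_mul_expR D0 (fun s _ => y0 s) d1 d2.
  apply: dini_leW; rewrite -/(y t) -/(z t) -sqr_nV.
  apply: (@le_trans _ _ ((- nu * y t + (nu * N ^+ 2 + nu^-1) * eps ^+ 2) *
      expR (D * z t))).
    rewrite ler_wpM2r ?expR_ge0 // le_eqVlt; apply/orP; left; apply/eqP.
    by rewrite NE /D; field; rewrite gt_eqF.
  rewrite mulrDl -mulrA -/(Y t) lerD2l /c ler_wpM2l //.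
    by rewrite mulr_ge0 ?sqr_ge0 // ltW.
  by rewrite ler_expR ler_wpM2l //; exact: hZ.
have gw := dini_gronwall nu0 c0 (Y0 T0) Yc Yd.
have q0 : 0 <= Y T0 / (e ^+ 2 / 2) / nu.
  exact: divr_ge0 (divr_ge0 (Y0 T0) (ltW e20)) (ltW nu0).
(* By exp(-x) <= 1 / (1 + x), the initial term of the Gronwall bound is below e^2 / 2 as soon as nu
   (t - T0) >= Y(T0) / (e^2 / 2). *)
exists (T0 + Y T0 / (e ^+ 2 / 2) / nu); first exact: addr_ge0.
move=> t Tt.
have T0t : T0 <= t by apply: le_trans Tt; rewrite lerDl.
have t0 : 0 <= t by exact: le_trans T0t.
apply: ler_of_sqr; first exact: ltW.
rewrite sqr_nH -/(w t) -/(y t).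
apply: (@le_trans _ _ (Y t)).
  rewrite ler_peMr // -[leLHS]expR0 ler_expR mulr_ge0 //; exact: S0_ge0.
apply: le_trans (gw t T0t) _; rewrite cE.
suff : Y T0 * expR (- nu * (t - T0)) <= e ^+ 2 / 2 by lra.
have x0 : 0 <= nu * (t - T0) by rewrite mulr_ge0 ?subr_ge0 // ltW.
have l1 : Y T0 <= e ^+ 2 / 2 * (nu * (t - T0)).
  have : Y T0 / (e ^+ 2 / 2) / nu <= t - T0 by rewrite lerBrDl.
  by rewrite ler_pdivrMr // ler_pdivrMr //; lra.
have l2 : (1 + nu * (t - T0)) * expR (- nu * (t - T0)) <= 1.
  apply: (@le_trans _ _ (expR (nu * (t - T0)) * expR (- nu * (t - T0)))).
    by rewrite ler_wpM2r ?expR_ge0 // expR_ge1Dx.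
  by rewrite -expRD mulNr subrr expR0.
have E0 := expR_ge0 (- nu * (t - T0)).
apply: (@le_trans _ _ (e ^+ 2 / 2 * ((1 + nu * (t - T0)) * expR (- nu * (t - T0))))).
  rewrite mulrA ler_wpM2r //; lra.
by rewrite ler_piMr // ltW.
Qed.

End DeterminingModes.

Theorem theorem4p6 (R : realType) (nu : R) (hnu : 0 < nu) :
  synchronization nu -> finite_determining_modes nu.
Proof. by move=> _; exact: determining_modes. Qed.
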